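(* Let $p$ be a prime, $K_0$ a field complete with respect to a discrete valuation whose residue field is perfect of characteristic $p$ (the characteristic of $K_0$ may be $0$ or $p$), and $K_n/K_0$ a totally ramified Galois extension of degree $p^n$ with group $G$. Let $T\geq 1$ be an integer. Suppose that the chain $(H_i)$, the elements $\sigma_i$ and the elements $X_j$ (as described in the context) can be chosen so that Assumptions (A1), (A2) and (A3) (with tolerance $T$) hold, and define $\lambda_t$ and $\Psi_i$ as in the context. Then: (i) the elements $\lambda_t\in K_n$ ($t\in\mathbb{Z}$) satisfy $v_n(\lambda_t)=t$ and $\lambda_{t+p^n}=\pi_0\lambda_t$ for all $t$; (ii) the elements $\Psi_1,\dots,\Psi_n\in K_0[G]$ satisfy $\Psi_i(1)=0$, and for all $1\leq i\leq n$ and $j\in\mathbb{Z}$, $$\Psi_i\lambda_j\equiv\begin{cases}\lambda_{j+p^{n-i}b_i}&\text{if }\mathfrak{a}(j)_{(n-i)}\geq 1,\\ 0&\text{if }\mathfrak{a}(j)_{(n-i)}=0,\end{cases}\qquad\text{modulo }\lambda_{j+p^{n-i}b_i}\mathfrak{P}_n^{T},$$ where $\mathfrak{a}(j)_{(n-i)}$ is the coefficient of $p^{n-i}$ in the base-$p$ expansion of $\mathfrak{a}(j)$.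
   Context: Notation: $v_n$ is the normalized valuation of $K_n$ ($v_n(K_n^\times)=\mathbb{Z}$), $\pi_n$ a prime element of $K_n$, $\mathfrak{O}_n$ its valuation ring with maximal ideal $\mathfrak{P}_n$; $\pi_0$ is a fixed prime element of $K_0$. The ramification groups are $G_t=\{\sigma\in G: v_n(\sigma(\pi_n)-\pi_n)\geq t+1\}$. Choose a chain of subgroups $G=H_0\supset H_1\supset\cdots\supset H_n=\{e\}$ with $H_i$ normal in $H_{i-1}$, $H_{i-1}/H_i\cong C_p$, such that every ramification group $G_t$ equals some $H_i$; choose $\sigma_i\in H_{i-1}\setminus H_i$. Let $K_i$ be the fixed field of $H_i$, $v_i$ the normalized valuation of $K_i$, and $b_i=v_n((\sigma_i-1)\pi_n)-1$ (so $b_1\le\dots\le b_n$ are the lower ramification numbers). Assumption (A1): $p\nmid b_1$. Assumption (A2): there is an integer $0\le b<p^n$ with $b_i\equiv b\bmod p^n$ for all $i$. Choose $X_j\in K_j$ ($1\le j\le n$) with $v_j(X_j)=-b_j$ and $v_j((\sigma_j-1)X_j-1)>0$. For $1\le i<j\le n$ fix a decomposition $(\sigma_i-1)X_j=\mu_{i,j}+\epsilon_{i,j}$ with $\mu_{i,j}\in K_0$, $\epsilon_{i,j}\in K_j$, $v_j(\mu_{i,j})=b_i-b_j<v_j(\epsilon_{i,j})$ (possible under (A2)); put $\mu_{j,j}=1$, $\epsilon_{j,j}=(\sigma_j-1)X_j-1$. Assumption (A3) with tolerance $T$: for all $1\le i\le j\le n$, $v_n(\epsilon_{i,j})-v_n(\mu_{i,j})\geq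 (p-1)\sum_{k=1}^{i-1}p^{n-k-1}b_k+(p^{n-i}-p^{n-j})b_i+T$. Binomials: $\binom{Y}{s}=Y(Y-1)\cdots(Y-s+1)/s!$ for $s\ge0$, and $\binom{Y}{s}=0$ for $s<0$. For $0\le a<p^n$ write $a=\sum_{i=1}^n a_{(n-i)}p^{n-i}$ with $0\le a_{(k)}<p$ and set $\rho_a=\prod_{i=1}^n\binom{X_i}{a_{(n-i)}}\in K_n$. For $t\in\mathbb{Z}$ let $\mathfrak{a}(t)$ be the unique integer with $0\le\mathfrak{a}(t)<p^n$ and $\mathfrak{a}(t)\equiv -tb^{-1}\bmod p^n$, let $f_t=(t-v_n(\rho_{\mathfrak{a}(t)}))/p^n\in\mathbb{Z}$, and $\lambda_t=\pi_0^{f_t}\rho_{\mathfrak{a}(t)}$. Truncated exponentiation: for $\Theta\in K_0[G]$ and $c\in K_0$, $\Theta^{[c]}=\sum_{s=0}^{p-1}\binom{c}{s}(\Theta-1)^s$. Define $\Theta_n=\sigma_n$ and, for $1\le i\le n-1$, $\Theta_i=\sigma_i\,\Theta_n^{[-\mu_{i,n}]}\Theta_{n-1}^{[-\mu_{i,n-1}]}\cdots\Theta_{i+1}^{[-\mu_{i,i+1}]}$, and $\Psi_i=\Theta_i-1\in K_0[G]$, acting on $K_n$ via the Galois action. *)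

(* Defs.v *)
From HB Require Import structures.
From mathcomp Require Import all_boot all_order all_algebra.
From mathcomp Require Import all_fingroup all_solvable all_field.
From mathcomp Require Import ring_quotient constructive_ereal.

Set Implicit Arguments.
Unset Strict Implicit.
Unset Printing Implicit Defensive.

Import Order.TTheory GRing.Theory Num.Theory.

Local Open Scope ring_scope.

(* Normalized discrete valuations take their values in Z together with +oo,   *)
(* inside \bar int; -oo is never a value.                                     *)
Record discrete_valuation (K : fieldType) := DiscreteValuation {
  dval :> K -> \bar int;
  dval0 : dval 0 = +oo%E;
  dval_fin : forall x, x != 0 -> dval x \is a fin_num;
  dvalM : forall x y, dval (x * y) = (dval x + dval y)%E;
  dvalD : forall x y, (Order.min (dval x) (dval y) <= dval (x + y))%E;
  dval_surj : forall m : int, exists2 x, x != 0 & dval x = m%:E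
}.

Section ValuationRing.
Variables (K : fieldType) (v : discrete_valuation K).

Lemma dval1 : v 1 = 0%E.
Proof.
have := dvalM v 1 1; have := dval_fin v (oner_neq0 K); rewrite mulr1.
case: (v 1) => //= r _ [] /eqP; rewrite -subr_eq0 opprD addNKr oppr_eq0.
by move/eqP->.
Qed.

Lemma dvalN x : v (- x) = v x.
Proof.
suff vN1 : v (- 1) = 0%E by rewrite -mulN1r dvalM vN1 add0e.
have := dvalM v (- 1) (- 1).
have := @dval_fin _ v (- 1); rewrite oppr_eq0 oner_eq0 => /(_ isT).
rewrite mulN1r opprK dval1; case: (v (- 1)) => //= r _ [] /esym/eqP.
by rewrite -mulr2n mulrn_eq0 /= => /eqP->.
Qed.

Definition valuation_ring : {pred K} := [pred x | (0 <= v x)%E].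

Fact valuation_ring_subring : subring_closed valuation_ring.
Proof.
split=> [|x y|x y]; rewrite !inE ?dval1 // => vx vy.
  by apply: le_trans (dvalD _ _ _); rewrite dvalN le_min vx.
by rewrite dvalM adde_ge0.
Qed.
HB.instance Definition _ :=
  GRing.isSubringClosed.Build K valuation_ring valuation_ring_subring.

Definition vring := {x : K | x \in valuation_ring}.
HB.instance Definition _ := SubChoice.on vring.
HB.instance Definition _ := [SubChoice_isSubComNzRing of vring by <:].

Definition vmax : {pred vring} := [pred x | (0 < v (val x))%E].

Fact vmax_idealr : idealr_closed vmax.
Proof.
split=> [||a x y]; rewrite !inE ?rmorph0 ?rmorph1 ?dval0 ?dval1 //= => vx vy.
apply: lt_le_trans (dvalD v (val a * val x) (val y)).
rewrite lt_min vy andbT dvalM; have := valP a; rewrite inE; move: vx.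
case: (v (val a)) (v (val x)) => [r||] [s||] //=.
by rewrite !lte_fin lee_fin => s_gt0 r_ge0; rewrite ltr_wpDl.
Qed.
HB.instance Definition _ := isIdealr.Build vring vmax vmax_idealr.

Definition residue_ring := {ideal_quot vmax}.
HB.instance Definition _ := GRing.ComNzRing.on residue_ring.

Definition residue_perfect_pchar (p : nat) :=
  (p \in [pchar residue_ring]) /\
  (forall a : residue_ring, exists c : residue_ring, c ^+ p = a).

Definition valuation_complete :=
  forall u : nat -> K,
    (forall m : int, exists N : nat, forall i j : nat,
       (N <= i)%N -> (N <= j)%N -> (m%:E <= v (u i - u j)%R)%E) ->
    exists l : K, forall m : int, exists N : nat, forall i : nat,
       (N <= i)%N -> (m%:E <= v (u i - l)%R)%E.

(* The T-th power of the maximal ideal of the valuation ring.                 *)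
Definition max_ideal_pow (T : nat) : {pred K} := [pred x | (T%:Z%:E <= v x)%E].

End ValuationRing.

Section GaloisGroupRing.
Variables (F : fieldType) (L : splittingFieldType F).
Local Notation G := (gal_of {:L}).

(* The group ring F[G], with its elements written as coefficient functions.   *)
(* MathComp's group law on gal_of is (s * t)%g a = t (s a), the opposite of   *)
(* the composition law s t := s \o t on the Galois group. The convolution     *)
(* below is the one for composition, so that gr_act is a left action.           *)
Definition gal_ring := {ffun G -> F^o}.
HB.instance Definition _ := GRing.Lmodule.on gal_ring.

Definition gr_of (s : G) : gal_ring := [ffun t => (t == s)%:R].
Definition gr_mul (f g : gal_ring) : gal_ring :=
  [ffun u => \sum_(s : G) f s * g (u * s^-1)%g].

Fact gr_mulA : associative gr_mul.
Proof.
move=> f g h; apply/ffunP=> u; rewrite !ffunE.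
under eq_bigr do rewrite ffunE mulr_sumr.
under [RHS]eq_bigr do rewrite ffunE mulr_suml.
rewrite [RHS]exchange_big /=; apply: eq_bigr => s _.
rewrite [RHS](reindex_inj (mulIg s)) /=; apply: eq_bigr => t _.
by rewrite mulgK invMg !mulgA mulrA.
Qed.

Fact gr_mul1l : left_id (gr_of 1%g) gr_mul.
Proof.
move=> f; apply/ffunP=> u; rewrite ffunE (bigD1 1%g) //= big1 => [|s /negPf s1].
  by rewrite ffunE eqxx mul1r invg1 mulg1 addr0.
by rewrite ffunE s1 mul0r.
Qed.

Fact gr_mul1r : right_id (gr_of 1%g) gr_mul.
Proof.
move=> f; apply/ffunP=> u; rewrite ffunE (bigD1 u) //= big1 => [|s /negPf su].
  by rewrite ffunE mulgV eqxx mulr1 addr0.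
by rewrite ffunE -eq_mulgV1 eq_sym su mulr0.
Qed.

Fact gr_mulDl : left_distributive gr_mul +%R.
Proof.
move=> f g h; apply/ffunP=> u; rewrite !ffunE -big_split /=.
by apply: eq_bigr => s _; rewrite ffunE mulrDl.
Qed.

Fact gr_mulDr : right_distributive gr_mul +%R.
Proof.
move=> f g h; apply/ffunP=> u; rewrite !ffunE -big_split /=.
by apply: eq_bigr => s _; rewrite ffunE mulrDr.
Qed.

Fact gr_one_neq0 : gr_of 1%g != 0.
Proof.
apply/eqP=> /ffunP/(_ 1%g); rewrite !ffunE eqxx => /eqP.
by rewrite oner_eq0.
Qed.

HB.instance Definition _ := GRing.Zmodule_isNzRing.Build gal_ring
  gr_mulA gr_mul1l gr_mul1r gr_mulDl gr_mulDr gr_one_neq0.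

Definition gr_act (f : gal_ring) (x : L) : L := \sum_(s : G) f s *: s x.

Lemma gr_act_of (s : G) x : gr_act (gr_of s) x = s x.
Proof.
rewrite /gr_act (bigD1 s) //= big1 => [|t /negPf ts].
  by rewrite ffunE eqxx scale1r addr0.
by rewrite ffunE ts scale0r.
Qed.

Lemma gr_actM f g x : gr_act (f * g) x = gr_act f (gr_act g x).
Proof.
rewrite /gr_act; under eq_bigr do rewrite ffunE scaler_suml.
rewrite exchange_big /=; apply: eq_bigr => s _.
rewrite linear_sum scaler_sumr (reindex_inj (mulIg s)) /=.
apply: eq_bigr => t _.
by rewrite mulgK linearZ /= scalerA galM ?memvf.
Qed.

End GaloisGroupRing.

(* Y (Y - 1) ... (Y - s + 1) / s!, in any field where s! is invertible.       *)
Definition fbinom (K : fieldType) (Y : K) (s : nat) : K :=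
  (\prod_(k < s) (Y - k%:R)) / (s`!)%:R.

Definition trunc_exp (F : fieldType) (L : splittingFieldType F) (p : nat)
    (Th : gal_ring L) (c : F) : gal_ring L :=
  \sum_(s < p) fbinom c s *: (Th - 1) ^+ s.

(* The coefficient of p ^ k in the base-p expansion of a.                     *)
Definition digit (p a k : nat) : nat := ((a %/ p ^ k) %% p)%N.

Section Extension.
Variables (F : fieldType) (L : splittingFieldType F).
Variables (v0 : discrete_valuation F) (vL : discrete_valuation L).

(* vL extends v0 with ramification index e.                                   *)
Definition has_ram_index (e : nat) :=
  (0 < e)%N /\ forall x : F, vL x%:A = (e%:Z%:E * v0 x)%E.

Definition totally_ramified := has_ram_index (\dim {:L}).

(* w, restricted to the intermediate field E, is the restriction of vL to E   *)
(* rescaled so that its value group is Z; w is irrelevant outside of E.       *)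
Definition normalized_on (E : {vspace L}) (w : L -> \bar int) :=
  (exists2 e : nat, (0 < e)%N &
     forall x, x \in E -> vL x = (e%:Z%:E * w x)%E) /\
  (exists2 x, x \in E & w x = 1%:E).

Definition ramification_group (piL : L) (t : int) : {set gal_of {:L}} :=
  [set s in 'Gal({:L} / 1)%g | ((t + 1)%:E <= vL (s piL - piL)%R)%E].

Definition ram_number (piL : L) (s : gal_of {:L}) : int :=
  fine (vL (s piL - piL)) - 1.

Section Scaffold.
Variables (p n b : nat) (X : nat -> L) (pi0 : F).

Definition rho (a : nat) : L :=
  \prod_(1 <= i < n.+1) fbinom (X i) (digit p a (n - i)).

(* The Bezout coefficient u of u * b + w * p ^ n = gcd (b, p ^ n) is an       *)
(* inverse of b modulo p ^ n when p does not divide b.                        *)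
Definition frak_a (t : int) : nat :=
  `|((- t * (egcdz b (p ^ n)%N).1) %% (p ^ n)%N)%Z|%N.

(* The quotient is exact under the assumptions on the X i.                    *)
Definition lambda (t : int) : L :=
  pi0 ^ ((t - fine (vL (rho (frak_a t)))) %/ (p ^ n)%N)%Z *: rho (frak_a t).

End Scaffold.
End Extension.

Definition lcong (K : fieldType) (v : discrete_valuation K) (l : K) (T : nat)
    (x y : K) :=
  exists2 z, z \in max_ideal_pow v T & x - y = l * z.

(* Main.v *)
(** Write c_i = p^(n-i) b_i and E_i = (p-1) sum_(k<i) p^(n-k-1) b_k, and let
    w(a) be the valuation of rho_a, namely -sum_k a_(n-k) c_k.  The w(a) are
    distinct modulo p^n, so the rho_a form a K_0-basis along which valuations
    can be computed termwise.  By downward induction on i one shows that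
    Psi_i rho_a equals rho_(a - p^(n-i)) (or 0) up to an error of valuation at
    least w(a) + c_i + E_i + T.  Given this for all j > i, Vandermonde's
    identity shows that Theta_j^[-mu_(i,j)] replaces X_j by X_j - mu_(i,j) in
    the binomials; the error is acceptable because the b_k increase, so that
    E_j + p^(n-j) b_i >= E_i + c_i.  Applying sigma_i undoes these shifts up to
    the eps_(i,j), which (A3) bounds, and replaces X_i by X_i + 1, so that
    Vandermonde's identity, now with the shift 1, produces the main term.

    The Galois group preserves the valuation since a uniformizer of K_n is a
    root of an Eisenstein polynomial.  The ramification index of K_n over K_j
    is |H_j|: it divides |H_j| because the norm of the uniformizer has
    valuation |H_j|, and powers of a uniformizer of K_j are independent over
    K_0, which bounds it from below. *)

Require Import Defs.
From HB Require Import structures.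
From mathcomp Require Import all_boot all_order all_algebra.
From mathcomp Require Import all_fingroup all_solvable all_field.
From mathcomp Require Import ring_quotient constructive_ereal zify ring.

Set Implicit Arguments.
Unset Strict Implicit.
Unset Printing Implicit Defensive.

Import Order.TTheory GRing.Theory Num.Theory.
Local Open Scope ring_scope.

(** * Lower bounds for valuations *)

Section Valuation.
Variables (K : fieldType) (v : discrete_valuation K).
Implicit Types (m : int) (x y : K).

Definition vge m x := (m%:E <= v x)%E.

Lemma vge0 m : vge m 0.
Proof. by rewrite /vge dval0 leey. Qed.

Lemma vgeW m m' x : m' <= m -> vge m x -> vge m' x.
Proof. by move=> le_m; apply: le_trans; rewrite lee_fin. Qed.

Lemma dval_vge m x : v x = m%:E -> vge m x.
Proof. by rewrite /vge => ->. Qed.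

Lemma vgeN m x : vge m (- x) = vge m x.
Proof. by rewrite /vge dvalN. Qed.

Lemma vgeD m x y : vge m x -> vge m y -> vge m (x + y).
Proof.
by move=> mx my; apply: le_trans (dvalD _ _ _); rewrite le_min; apply/andP.
Qed.

Lemma vgeB m x y : vge m x -> vge m y -> vge m (x - y).
Proof. by move=> mx my; apply: vgeD; rewrite ?vgeN. Qed.

Lemma vgeB_trans y m x z : vge m (x - y) -> vge m (y - z) -> vge m (x - z).
Proof. by move=> xy yz; rewrite -(subrK y x) -addrA; apply: vgeD. Qed.

Lemma vge_sum I (r : seq I) (P : pred I) (f : I -> K) m :
  (forall i, P i -> vge m (f i)) -> vge m (\sum_(i <- r | P i) f i).
Proof. by move=> mf; elim/big_ind: _ => //; [apply: vge0 | apply: vgeD]. Qed.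

Lemma vgeM m m' x y : vge m x -> vge m' y -> vge (m + m') (x * y).
Proof. by rewrite /vge dvalM EFinD => mx my; apply: leeD. Qed.

Lemma vge_prod I (r : seq I) (P : pred I) (m : I -> int) (f : I -> K) :
  (forall i, P i -> vge (m i) (f i)) ->
  vge (\sum_(i <- r | P i) m i) (\prod_(i <- r | P i) f i).
Proof.
move=> mf; elim/big_ind2: _ => //; first by rewrite /vge dval1.
by move=> *; apply: vgeM.
Qed.

Lemma vgeX m x k : vge m x -> vge (m *+ k) (x ^+ k).
Proof.
move=> mx; elim: k => [|k IHk]; first by rewrite /vge dval1.
by rewrite mulrS exprS; apply: vgeM.
Qed.

Lemma vge_natr (k : nat) : vge 0 k%:R.
Proof.
by elim: k => [|k IHk]; rewrite ?vge0 // -addn1 natrD vgeD // /vge dval1.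
Qed.

Lemma vge_prodB I (r : seq I) (P : pred I) (m : I -> int) (e : int)
    (f g : I -> K) :
  (forall i, P i -> [/\ vge (m i) (f i), vge (m i) (g i)
                      & vge (m i + e) (f i - g i)]) ->
  vge (\sum_(i <- r | P i) m i + e)
    (\prod_(i <- r | P i) f i - \prod_(i <- r | P i) g i).
Proof.
move=> mfg; elim: r => [|i r IHr]; first by rewrite !big_nil subrr vge0.
rewrite !big_cons; case: ifP => // Pi; have [fi gi fgi] := mfg i Pi.
set f' := \prod_(j <- r | P j) f j; set g' := \prod_(j <- r | P j) g j.
have -> : f i * f' - g i * g' = (f i - g i) * f' + g i * (f' - g') by ring.
apply: vgeD; last by rewrite -addrA; apply: vgeM.
rewrite addrAC; apply: vgeM => //; apply: vge_prod => j Pj.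
by case: (mfg j Pj).
Qed.

Lemma dval_fineK x : x != 0 -> v x = (fine (v x))%:E.
Proof. by move/(dval_fin v)/fineK. Qed.

Lemma dval_neq0 x m : v x = m%:E -> x != 0.
Proof. by apply: contra_eq_neq => ->; rewrite dval0. Qed.

Lemma vge_all_eq0 x : (forall m, vge m x) -> x = 0.
Proof.
move=> vx; apply/eqP/negPn/negP => /dval_fineK Ex.
by have := vx (fine (v x) + 1); rewrite /vge {2}Ex lee_fin gerDl.
Qed.

Lemma dvalX x m k : v x = m%:E -> v (x ^+ k) = (m *+ k)%:E.
Proof.
move=> vx; elim: k => [|k IHk]; first by rewrite dval1.
by rewrite mulrS exprS dvalM IHk vx.
Qed.

Lemma dvalV x m : v x = m%:E -> v x^-1 = (- m)%:E.
Proof.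
move=> vx; have x_neq0 := dval_neq0 vx; have := dvalM v x x^-1.
rewrite divff // dval1 vx (dval_fineK (invr_neq0 x_neq0)) => -[] /esym/eqP.
by rewrite addr_eq0 => /eqP->; rewrite opprK.
Qed.

Lemma dval_exprz x m (k : int) : v x = m%:E -> v (x ^ k) = (m * k)%:E.
Proof.
case: k => k vx; first by rewrite (dvalX k vx) pmulrn mulrzz.
by rewrite (dvalV (dvalX k.+1 vx)) pmulrn mulrzz NegzE mulrN.
Qed.

Lemma dval_prod I (r : seq I) (P : pred I) (m : I -> int) (f : I -> K) :
  (forall i, P i -> v (f i) = (m i)%:E) ->
  v (\prod_(i <- r | P i) f i) = (\sum_(i <- r | P i) m i)%:E.
Proof.
move=> mf; elim/big_ind2: _ => //; first by rewrite dval1.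
by move=> x1 x2 y1 y2 v1 v2; rewrite dvalM v1 v2.
Qed.

Lemma vgeS_dval_gt m x : vge (m + 1) x = (m%:E < v x)%E.
Proof.
by rewrite /vge; case: (v x) => [r||]; rewrite ?leey ?ltey // lee_fin lezD1.
Qed.

Lemma dvalDl m x y : v x = m%:E -> vge (m + 1) y -> v (x + y) = m%:E.
Proof.
move=> vx vy; apply/eqP; rewrite eq_le leNgt -vgeS_dval_gt; apply/andP; split.
  apply/negP => /vgeB/(_ vy); rewrite addrK vgeS_dval_gt vx ltxx //.
by apply: vgeD; [apply: dval_vge | apply: vgeW vy; rewrite lerDl].
Qed.

Lemma lcong_vge (l : K) m (T : nat) x y :
  v l = m%:E -> vge (m + T%:Z) (x - y) -> lcong v l T x y.
Proof.
move=> vl vxy; exists ((x - y) / l); last first.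
  by rewrite mulrC divfK ?(dval_neq0 vl).
rewrite inE; apply: vgeW (vgeM vxy (dval_vge (dvalV vl))); lia.
Qed.

End Valuation.

Lemma residue_pchar_dval (K : fieldType) (v : discrete_valuation K) p :
  p \in [pchar (residue_ring v)] -> vge v 1 p%:R.
Proof.
case/andP=> _ /eqP p_eq0.
have : (p%:R : vring v) \in @vmax K v.
  rewrite -[p%:R]subr0 Quotient.idealrBE; apply/eqP.
  have -> : \pi_{ideal_quot (@vmax K v)}%qT (p%:R : vring v) =
      p%:R :> residue_ring v.
    exact: rmorph_nat.
  by rewrite p_eq0 (rmorph0 (\pi_{ideal_quot (@vmax K v)}%qT)).
rewrite inE -[X in vge _ X]add0r vgeS_dval_gt.
by rewrite (rmorph_nat (val : vring v -> K)).
Qed.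

(** * Truncated binomial coefficients *)

Lemma rmorph_fbinom (K K' : fieldType) (f : {rmorphism K -> K'}) Y s :
  f (fbinom Y s) = fbinom (f Y) s.
Proof.
rewrite /fbinom fmorph_div rmorph_nat rmorph_prod; congr (_ / _).
by apply: eq_bigr => k _; rewrite rmorphB rmorph_nat.
Qed.

Lemma fbinom0 (K : fieldType) (Y : K) : fbinom Y 0 = 1.
Proof. by rewrite /fbinom big_ord0 mul1r invr1. Qed.

Lemma fbinom1 (K : fieldType) s : fbinom (1 : K) s = (s <= 1)%:R.
Proof.
case: s => [|[|s]]; first exact: fbinom0.
  by rewrite /fbinom big_ord1 subr0 divr1.
by rewrite /fbinom 2!big_ord_recl /= subrr mul0r mulr0 mul0r.
Qed.

Section Vandermonde.
Variables (K : fieldType) (p : nat).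
Hypothesis natr_neq0 : forall m, (0 < m < p)%N -> m%:R != 0 :> K.

Lemma fact_neq0 s : (s < p)%N -> (s`!)%:R != 0 :> K.
Proof.
elim: s => [|s IHs] lt_s; first by rewrite oner_neq0.
by rewrite factS natrM mulf_neq0 ?IHs ?(ltnW lt_s) // natr_neq0 // lt_s.
Qed.

Lemma fbinomS (Y : K) s : (s.+1 < p)%N ->
  s.+1%:R * fbinom Y s.+1 = (Y - s%:R) * fbinom Y s.
Proof.
move=> lt_s; have := fact_neq0 lt_s.
rewrite /fbinom big_ord_recr factS natrM /= mulf_eq0 negb_or.
move=> /andP[s_neq0 factS_neq0].
by move: s.+1%:R s_neq0 => r r_neq0; field; rewrite factS_neq0.
Qed.

(* Multiplying by s+1 reduces to the identity for s, with the factor          *)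
(* X + Y - s distributed over the terms as (X - (s - k)) + (Y - k).           *)
Lemma fbinom_addl (X Y : K) s : (s < p)%N ->
  fbinom (X + Y) s = \sum_(k < s.+1) fbinom Y k * fbinom X (s - k).
Proof.
elim: s => [|s IHs] lt_s; first by rewrite big_ord1 !fbinom0 mulr1.
have s_neq0 : s.+1%:R != 0 :> K by rewrite natr_neq0.
apply: (mulfI s_neq0); rewrite fbinomS // IHs ?(ltnW lt_s) // !mulr_sumr.
pose F k := k%:R * fbinom Y k * fbinom X (s.+1 - k).
pose G k := (s.+1 - k)%:R * fbinom Y k * fbinom X (s.+1 - k).
transitivity (\sum_(k < s.+1) (F k.+1 + G k)).
  apply: eq_bigr => k _; rewrite /F /G subSS fbinomS; last first.
    by apply: leq_ltn_trans lt_s; apply: ltn_ord.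
  have le_ks : (k <= s)%N by rewrite -ltnS.
  rewrite subSn // [_.+1%:R * _ * _]mulrAC fbinomS; last first.
    by apply: leq_ltn_trans lt_s; rewrite ltnS leq_subr.
  by rewrite natrB //; ring.
rewrite big_split /=; transitivity (\sum_(k < s.+2) F k + \sum_(k < s.+2) G k).
  rewrite [in RHS]big_ord_recl [X in _ = _ + X]big_ord_recr /=.
  by rewrite /F /G subnn !mul0r addr0 add0r.
rewrite -big_split; apply: eq_bigr => k _; rewrite /F /G /=.
have le_ks : (k <= s.+1)%N by rewrite -ltnS.
by rewrite natrB //; ring.
Qed.

End Vandermonde.

Section BinomialValuation.
Variables (K : fieldType) (v : discrete_valuation K) (p : nat).
Hypotheses (p_pr : prime p) (v_p : vge v 1 p%:R).

Lemma dval_natr m : (0 < m < p)%N -> v m%:R = 0%E.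
Proof.
case/andP=> m_gt0 lt_mp.
have cop : coprime m p by rewrite coprime_sym prime_coprime // gtnNdvd.
case: (egcdnP p m_gt0) => u w Euw _.
have v_um : v (u * m)%:R = 0%:E.
  rewrite Euw (eqP cop) natrD natrM addrC; apply: dvalDl; first exact: dval1.
  by apply: vgeM; first exact: vge_natr.
have [] := (vge_natr v u, vge_natr v m); move: v_um; rewrite natrM dvalM /vge.
case: (v u%:R) (v m%:R) => [r||] [s||] // [r_s].
by rewrite !lee_fin => r_ge0 s_ge0; congr (_%:E); lia.
Qed.

Lemma natr_neq0 m : (0 < m < p)%N -> m%:R != 0 :> K.
Proof. by move/dval_natr; apply: dval_neq0. Qed.

Lemma dval_factV s : (s < p)%N -> v (s`!)%:R^-1 = 0%E.
Proof.
move=> lt_s; rewrite -[0%E]/((- 0)%:E); apply: dvalV.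
elim: s lt_s => [|s IHs] lt_s; first by rewrite dval1.
by rewrite factS natrM dvalM dval_natr ?add0e ?IHs // ltnW.
Qed.

Lemma vge_div_fact m x s : (s < p)%N -> vge v m x -> vge v m (x / (s`!)%:R).
Proof.
move=> lt_s vx; rewrite -[m]addr0; apply: vgeM vx _.
exact: dval_vge (dval_factV lt_s).
Qed.

Let sum_constN (c : int) s : - (c *+ s) = \sum_(k < s) (- c).
Proof. by rewrite sumr_const card_ord mulNrn. Qed.

Lemma vge_fbinom (c : int) Y s : 0 <= c -> vge v (- c) Y -> (s < p)%N ->
  vge v (- (c *+ s)) (fbinom Y s).
Proof.
move=> c_ge0 vY lt_s; apply: vge_div_fact => //; rewrite sum_constN.
apply: vge_prod => k _; apply: vgeB => //.
by apply: vgeW (vge_natr v k); rewrite oppr_le0.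
Qed.

Lemma dval_fbinom (c : int) Y s : 0 < c -> v Y = (- c)%:E -> (s < p)%N ->
  v (fbinom Y s) = (- (c *+ s))%:E.
Proof.
move=> c_gt0 vY lt_s; rewrite /fbinom dvalM dval_factV // adde0 sum_constN.
apply: dval_prod => k _; apply: dvalDl => //; rewrite vgeN.
by apply: vgeW (vge_natr v k); lia.
Qed.

Lemma vge_fbinomB (c e : int) Y z s : 0 <= c -> 0 <= e -> vge v (- c) Y ->
  vge v (- c + e) z -> (s < p)%N ->
  vge v (- (c *+ s) + e) (fbinom (Y + z) s - fbinom Y s).
Proof.
move=> c_ge0 e_ge0 vY vz lt_s; rewrite /fbinom -mulrBl.
apply: vge_div_fact => //; rewrite sum_constN; apply: vge_prodB => k _.
have vYk : vge v (- c) (Y - k%:R).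
  by apply: vgeB => //; apply: vgeW (vge_natr v k); rewrite oppr_le0.
have -> : Y + z - k%:R = Y - k%:R + z by ring.
split=> //; last by rewrite addrAC subrr add0r.
by apply: vgeD => //; apply: vgeW vz; rewrite lerDl.
Qed.

End BinomialValuation.

(** * Totally ramified extensions *)

Section RamificationIndex.
Variables (F : fieldType) (L : splittingFieldType F).
Variables (v0 : discrete_valuation F) (v : discrete_valuation L) (N : nat).
Hypothesis ram : has_ram_index v0 v N.

Lemma ram_gt0 : (0 < N)%N. Proof. by case: ram. Qed.

Lemma dval_alg (a : F) m : v0 a = m%:E -> v a%:A = (N%:Z * m)%:E.
Proof. by case: ram => _ -> ->. Qed.

Lemma vge_alg (a : F) m : vge v0 m a -> vge v (N%:Z * m) a%:A.
Proof.
case: ram => N_gt0 vA; rewrite /vge vA; case: (v0 a) => [r||] //.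
  by rewrite !lee_fin => /ler_wpM2l->.
by rewrite gt0_muley ?leey // lte_fin ltz_nat.
Qed.

Lemma residue_pchar_dval_ext p :
  p \in [pchar (residue_ring v0)] -> vge v 1 p%:R.
Proof.
move/residue_pchar_dval/vge_alg; rewrite mulr1 -in_algE rmorph_nat.
by apply: vgeW; rewrite lez_nat ram_gt0.
Qed.

Lemma dval_scale (a : F) x k : a != 0 -> v x = k%:E ->
  v (a *: x) = (N%:Z * fine (v0 a) + k)%:E.
Proof.
by move=> /(dval_fineK v0)/dval_alg va vx; rewrite -mulr_algl dvalM va vx.
Qed.

Definition distinct_dvals_mod (I : Type) (r : I -> int) (e : I -> L) :=
  (forall i, v (e i) = (r i)%:E) /\
  (forall i j, (r i = r j %[mod N])%Z -> i = j).

(* The nonzero terms have distinct valuations, so a single one of them        *)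
(* attains the minimum.                                                       *)
Lemma vge_terms (I : finType) (r : I -> int) (e : I -> L) (a : I -> F) m :
  distinct_dvals_mod r e -> vge v m (\sum_i a i *: e i) ->
  forall i, vge v m (a i *: e i).
Proof.
case=> v_e r_inj vsum i; have [->|ai] := eqVneq (a i) 0.
  by rewrite scale0r vge0.
pose val j := N%:Z * fine (v0 (a j)) + r j.
have [k ak k_min] := @arg_minP _ _ I i (fun j => a j != 0) val ai.
suff vk : v (\sum_i a i *: e i) = (val k)%:E.
  move: vsum; rewrite /vge vk (dval_scale ai (v_e i)) !lee_fin => le_mk.
  exact: le_trans le_mk (k_min i ai).
rewrite (bigD1 k) //=; apply: dvalDl; first exact: dval_scale.
apply: vge_sum => j jk; have [->|aj] := eqVneq (a j) 0.
  by rewrite scale0r vge0.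
rewrite /vge (dval_scale aj (v_e j)) lee_fin lezD1 lt_neqAle k_min // andbT.
apply: contra jk => /eqP val_kj; apply/eqP/r_inj.
by have := congr1 (modz^~ N) val_kj; rewrite /val ![N%:Z * _]mulrC !modzMDl.
Qed.

Lemma distinct_dvals_exp x (e k : nat) : (0 < e)%N -> (e * k <= N)%N ->
  v x = e%:Z%:E ->
  distinct_dvals_mod (fun i : 'I_k => (e * i)%N%:Z) (fun i => x ^+ i).
Proof.
move=> e_gt0 le_ekN vx; split=> [i|i j].
  by rewrite (dvalX i vx) PoszM -mulr_natr natz.
have lt_eN (l : 'I_k) : (e * l < N)%N.
  by apply: leq_trans le_ekN; rewrite ltn_mul2l e_gt0 ltn_ord.
rewrite !modz_small ?lez_nat ?ltz_nat ?lt_eN // => -[] /eqP.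
by rewrite eqn_mul2l (gtn_eqF e_gt0) => /eqP/ord_inj.
Qed.

Section Tuple.
Variables (k : nat) (r : 'I_k -> int) (e : 'I_k -> L).
Hypothesis dist_e : distinct_dvals_mod r e.

Lemma distinct_dvals_free : free [tuple e i | i < k].
Proof.
apply/freeP => a sum0 i; have term_eq0 : a i *: e i = 0.
  apply: (@vge_all_eq0 _ v) => m; apply: (vge_terms dist_e).
  rewrite [X in vge v m X](_ : _ = 0) ?vge0 // -[RHS]sum0.
  apply: eq_bigr => j _.
  by rewrite (nth_map j) ?size_enum_ord // nth_ord_enum.
move/eqP: term_eq0.
by rewrite scaler_eq0 (negPf (dval_neq0 (dist_e.1 i))) orbF => /eqP.
Qed.

Lemma distinct_dvals_leq_dim (U : {vspace L}) :
  (forall i, e i \in U) -> (k <= \dim U)%N.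
Proof.
move=> eU; rewrite -[k in (k <= _)%N](size_tuple [tuple e i | i < k]).
rewrite -(eqP distinct_dvals_free).
by apply/dimvS/span_subvP => x /mapP[i _ ->].
Qed.

Hypothesis dimL : \dim {:L} = k.

Lemma distinct_dvals_span x : exists a : 'I_k -> F, x = \sum_i a i *: e i.
Proof.
set B := [tuple e i | i < k]; have basisB : basis_of fullv B.
  by rewrite basisEfree distinct_dvals_free subvf size_tuple dimL /=.
exists (coord B ^~ x); rewrite {1}(coord_basis basisB (memvf x)).
by apply: eq_bigr => i _; rewrite (nth_map i) ?size_enum_ord // nth_ord_enum.
Qed.

Lemma vge_linear (f : {linear L -> L}) (m : int) :
  (forall i, vge v (r i + m) (f (e i))) ->
  forall l x, vge v l x -> vge v (l + m) (f x).
Proof.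
move=> vf l x vx; have [a Ex] := distinct_dvals_span x.
rewrite Ex linear_sum; apply: vge_sum => i _.
have: vge v l (a i *: e i) by apply: (vge_terms dist_e); rewrite -Ex.
rewrite linearZ /=; have [->|ai] := eqVneq (a i) 0.
  by rewrite !scale0r !vge0.
rewrite {1}/vge (dval_scale ai (dist_e.1 i)) lee_fin => le_l.
rewrite -mulr_algl.
have va := dval_vge (dval_alg (dval_fineK v0 ai)).
by apply: vgeW (vgeM va (vf i)); rewrite addrA lerD2r.
Qed.

End Tuple.

End RamificationIndex.

Section TotallyRamified.
Variables (F : fieldType) (L : splittingFieldType F).
Variables (v0 : discrete_valuation F) (v : discrete_valuation L).
Hypothesis totram : totally_ramified v0 v.
Local Notation N := (\dim {:L}).

Section Uniformizer.
Variables (pi : L).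
Hypothesis v_pi : v pi = 1%:E.

Let dist_pi : distinct_dvals_mod v N (fun i : 'I_N => (1 * i)%N%:Z)
  (fun i : 'I_N => pi ^+ i).
Proof. by apply: distinct_dvals_exp; rewrite ?mul1n. Qed.

Lemma uniformizer_Eisenstein : exists2 a : 'I_N -> F,
  pi ^+ N = \sum_(i < N) a i *: pi ^+ i & forall i, vge v N (a i)%:A.
Proof.
have [a Ea] := distinct_dvals_span totram dist_pi erefl (pi ^+ N).
exists a => // i.
have vpiN : v (pi ^+ N) = N%:Z%:E by rewrite (dvalX N v_pi) natz.
have := @vge_terms _ _ _ _ _ totram _ _ _ a N dist_pi.
rewrite -Ea => /(_ (dval_vge vpiN) i).
have [->|ai] := eqVneq (a i) 0; first by rewrite !scale0r vge0.
rewrite /vge (dval_scale totram ai (dist_pi.1 i)).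
rewrite (dval_scale totram ai (dval1 v)) !lee_fin.
have := ltn_ord i; move: (fine _) => z; case: (lerP 1 z) => ?; nia.
Qed.

(* If v (s pi) <= 0, the Eisenstein equation would give s pi ^+ N a valuation *)
(* at least N + N * v (s pi).                                                 *)
Lemma vge_gal_uniformizer (s : gal_of {:L}) : vge v 1 (s pi).
Proof.
have [a Ea va] := uniformizer_Eisenstein.
have spi_neq0 : s pi != 0 by rewrite fmorph_eq0 (dval_neq0 v_pi).
have := congr1 s Ea; rewrite rmorphXn linear_sum.
have vspi := dval_fineK v spi_neq0; set t := fine _ in vspi.
rewrite /vge vspi lee_fin => Es; rewrite leNgt; apply/negP => t_lt1.
suff : vge v (N%:Z + N%:Z * t) (s pi ^+ N).
  by rewrite /vge (dvalX N vspi) lee_fin; have := ram_gt0 totram; lia.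
rewrite Es; apply: vge_sum => i _; rewrite linearZ /= rmorphXn -mulr_algl.
by apply: vgeW (vgeM (va i) (vgeX i (dval_vge vspi))); have := ltn_ord i; nia.
Qed.

Lemma vge_gal_of_uniformizer (s : gal_of {:L}) m x :
  vge v m x -> vge v m (s x).
Proof.
rewrite -{2}[m]addr0; apply: (vge_linear totram dist_pi erefl) => i.
rewrite addr0 rmorphXn mul1n; apply: vgeW (vgeX i (vge_gal_uniformizer s)).
by rewrite natz.
Qed.

Lemma gal_uniformizer_inj (s : gal_of {:L}) : s pi = pi -> s = 1%g.
Proof.
move=> spi; apply/eqP/gal_eqP => x _; rewrite gal_id.
have [a ->] := distinct_dvals_span totram dist_pi erefl x.
rewrite linear_sum; apply: eq_bigr => i _.
by rewrite linearZ rmorphXn; congr (_ *: _ ^+ _).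
Qed.

End Uniformizer.

Lemma dval_gal (s : gal_of {:L}) x : v (s x) = v x.
Proof.
have [pi _ v_pi] := dval_surj v 1.
have vge_gal := vge_gal_of_uniformizer v_pi.
have [->|x_neq0] := eqVneq x 0; first by rewrite linear0.
have sx_neq0 : s x != 0 by rewrite fmorph_eq0.
apply/eqP; rewrite eq_le; apply/andP; split; last first.
  by rewrite (dval_fineK v x_neq0); apply/vge_gal/dval_vge/dval_fineK.
have := vge_gal s^-1%g _ _ (dval_vge (dval_fineK v sx_neq0)).
by rewrite -galM ?memvf // mulgV gal_id /vge -dval_fineK.
Qed.

Lemma vge_gal (s : gal_of {:L}) m x : vge v m (s x) = vge v m x.
Proof. by rewrite /vge dval_gal. Qed.

Lemma dvdn_scaled_dval (E : {vspace L}) (w : L -> \bar int) (e m : nat) x :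
  (0 < e)%N -> (forall y, y \in E -> v y = (e%:Z%:E * w y)%E) ->
  x \in E -> v x = m%:Z%:E -> (e %| m)%N.
Proof.
move=> e_gt0 v_scaled xE; rewrite v_scaled //; case: (w x) => [r||].
- by case=> Em; rewrite -[(_ %| _)%N]/(e%:Z %| m%:Z)%Z -Em; apply: dvdz_mulr.
- by rewrite gt0_muley // lte_fin ltz_nat.
by rewrite gt0_muleNy // lte_fin ltz_nat.
Qed.

Lemma leq_dim_dval (E : {subfield L}) (e : nat) x :
  (0 < e)%N -> (e %| N)%N -> x \in E -> v x = e%:Z%:E ->
  (N <= e * \dim E)%N.
Proof.
move=> e_gt0 dvd_eN xE vx; rewrite mulnC -leq_divLR //.
have le_N : (e * (N %/ e) <= N)%N by rewrite mulnC divnK.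
apply: (distinct_dvals_leq_dim totram (distinct_dvals_exp e_gt0 le_N vx)) => i.
exact: rpredX.
Qed.

Lemma dval_galNorm (H : {group gal_of {:L}}) x : v x = 1%:E ->
  v (galNorm (fixedField H) {:L} x) = #|H|%:Z%:E.
Proof.
move=> vx; rewrite /galNorm gal_fixedField (@dval_prod _ v _ _ _ (fun=> 1)).
  by rewrite sumr_const natz.
by move=> s _; rewrite dval_gal.
Qed.

Lemma normalized_on_fixedField (H : {group gal_of {:L}}) (w : L -> \bar int) :
  normalized_on v (fixedField H) w ->
  forall x, x \in fixedField H -> v x = (#|H|%:Z%:E * w x)%E.
Proof.
case=> -[e e_gt0 v_scaled] [x0 x0E wx0].
have dvd_e := dvdn_scaled_dval e_gt0 v_scaled.
have dvd_eN : (e %| N)%N.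
  have [c _ vc] := dval_surj v0 1; apply: (dvd_e _ c%:A).
    by apply: rpredZ; apply: rpred1.
  by rewrite (dval_alg totram vc) mulr1.
have le_eH : (e <= #|H|)%N.
  have [pi _ v_pi] := dval_surj v 1; apply: dvdn_leq; first exact: cardG_gt0.
  apply: dvd_e (dval_galNorm H v_pi).
  by apply: mem_galNorm (memvf pi); apply: fixedField_galois.
suff le_He : (#|H| <= e)%N.
  by have -> : #|H| = e by apply/eqP; rewrite eqn_leq le_He.
rewrite -(leq_pmul2r (adim_gt0 (fixedField H))) dim_fixedField.
rewrite -dim_sup_field ?subvf //; apply: (leq_dim_dval e_gt0 dvd_eN x0E).
by rewrite v_scaled // wx0 mule1.
Qed.

End TotallyRamified.

(** * The action of the group ring *)

Section GroupRingAction.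
Variables (F : fieldType) (L : splittingFieldType F).
Implicit Types f g : gal_ring L.

Fact gr_act_linear f : linear (gr_act f).
Proof.
move=> a x y; rewrite /gr_act scaler_sumr -big_split; apply: eq_bigr => s _.
by rewrite linearP /= scalerDr !scalerA mulrC.
Qed.
HB.instance Definition _ f :=
  GRing.isLinear.Build F L L _ (gr_act f) (gr_act_linear f).

Lemma gr_actDl f g x : gr_act (f + g) x = gr_act f x + gr_act g x.
Proof.
by rewrite /gr_act -big_split; apply: eq_bigr => s _; rewrite ffunE scalerDl.
Qed.

Lemma gr_actZl a f x : gr_act (a *: f) x = a *: gr_act f x.
Proof.
by rewrite /gr_act scaler_sumr; apply: eq_bigr => s _; rewrite ffunE scalerA.
Qed.

Lemma gr_act_suml I (r : seq I) (P : pred I) (f : I -> gal_ring L) x :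
  gr_act (\sum_(i <- r | P i) f i) x = \sum_(i <- r | P i) gr_act (f i) x.
Proof.
elim/big_rec2: _ => [|i y1 y2 _ <-]; last exact: gr_actDl.
by rewrite /gr_act big1 // => s _; rewrite ffunE scale0r.
Qed.

Lemma gr_act1l x : gr_act (1 : gal_ring L) x = x.
Proof. by rewrite gr_act_of gal_id. Qed.

Lemma gr_act_sub1 f x : gr_act (f - 1) x = gr_act f x - x.
Proof. by rewrite gr_actDl -scaleN1r gr_actZl gr_act1l scaleN1r. Qed.

Lemma gr_act_trunc_exp p f a x : gr_act (trunc_exp p f a) x =
  \sum_(s < p) fbinom a s *: gr_act ((f - 1) ^+ s) x.
Proof. by rewrite gr_act_suml; apply: eq_bigr => s _; rewrite gr_actZl. Qed.

Lemma gr_act_prod_fix1 k (f : nat -> gal_ring L) :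
  (forall i, (i < k)%N -> gr_act (f i) 1 = 1) ->
  gr_act (\prod_(i < k) f i) 1 = 1.
Proof.
elim: k => [|k IHk] f1; first by rewrite big_ord0 gr_act1l.
by rewrite big_ord_recr gr_actM f1 // IHk // => i /ltnW; apply: f1.
Qed.

Lemma gr_act_trunc_exp_fix1 p f a : (0 < p)%N ->
  gr_act (f - 1) 1 = 0 -> gr_act (trunc_exp p f a) 1 = 1.
Proof.
case: p => // p _ f1; rewrite gr_act_trunc_exp big_ord_recl big1 => [|s _].
  by rewrite fbinom0 expr0 gr_act1l scale1r addr0.
by rewrite exprSr gr_actM f1 linear0 scaler0.
Qed.

End GroupRingAction.

(** * Products of binomials indexed by digits *)

Section BinomialProducts.
Variables (p n : nat) (F : fieldType) (L : splittingFieldType F).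
Variable v : discrete_valuation L.
Implicit Types (Y : nat -> L) (d : nat -> nat) (c : nat -> int).

Definition digits_lt d := forall k, (d k < p)%N.

Definition binom_prod Y d : L := \prod_(1 <= k < n.+1) fbinom (Y k) (d k).

Definition lowered_prod Y d i s : L :=
  if (s <= d i)%N then binom_prod Y [eta d with i |-> (d i - s)%N] else 0.

Definition weight c d : int := - \sum_(1 <= k < n.+1) c k *+ d k.

Lemma digits_lt_sub d i s :
  digits_lt d -> digits_lt [eta d with i |-> (d i - s)%N].
Proof.
move=> d_lt k /=; case: eqP => // _.
by apply: leq_ltn_trans (d_lt i); rewrite leq_subr.
Qed.

Lemma eq_binom_prod Y Y' d d' :
  (forall k, (1 <= k <= n)%N -> Y k = Y' k /\ d k = d' k) ->
  binom_prod Y d = binom_prod Y' d'.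
Proof. by move=> E; apply: eq_big_nat => k /E[-> ->]. Qed.

Lemma eq_weight c d d' :
  (forall k, (1 <= k <= n)%N -> d k = d' k) -> weight c d = weight c d'.
Proof. by move=> E; congr (- _); apply: eq_big_nat => k /E->. Qed.

Lemma lowered_prod0 Y d i : lowered_prod Y d i 0 = binom_prod Y d.
Proof.
rewrite /lowered_prod subn0; apply: eq_binom_prod => k _ /=.
by case: eqP => [->|].
Qed.

Lemma lowered_prodS Y d i s : (s <= d i)%N ->
  lowered_prod Y [eta d with i |-> (d i - s)%N] i 1 = lowered_prod Y d i s.+1.
Proof.
move=> le_s; rewrite /lowered_prod /= eqxx subn_gt0 -subnDA addn1.
by case: ifP => // _; apply: eq_binom_prod => k _ /=; case: eqP.
Qed.

Lemma weight_sub c d i s : (1 <= i <= n)%N -> (s <= d i)%N ->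
  weight c [eta d with i |-> (d i - s)%N] = weight c d + c i *+ s.
Proof.
move=> i_n le_s; rewrite /weight.
rewrite (bigD1_seq i) ?iota_uniq ?mem_index_iota ?ltnS //=.
rewrite [in RHS](bigD1_seq i) ?iota_uniq ?mem_index_iota ?ltnS //= eqxx.
under eq_bigr => k /negPf ki do rewrite ki.
by rewrite mulrnBr //; ring.
Qed.

Lemma gal_binom_prod (s : gal_of {:L}) Y d :
  s (binom_prod Y d) = binom_prod (s \o Y) d.
Proof.
by rewrite rmorph_prod; apply: eq_bigr => k _; rewrite rmorph_fbinom.
Qed.

Hypotheses (p_pr : prime p) (v_p : vge v 1 p%:R).

Let weightE c d : weight c d =
  \sum_(1 <= k < n.+1 | (1 <= k < n.+1)%N && true) (- (c k *+ d k)).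
Proof. by rewrite -big_nat_cond sumrN. Qed.

Lemma vge_binom_prod Y c d : digits_lt d ->
  (forall k, (1 <= k <= n)%N -> 0 <= c k /\ vge v (- c k) (Y k)) ->
  vge v (weight c d) (binom_prod Y d).
Proof.
move=> d_lt vY; rewrite weightE /binom_prod big_nat_cond.
apply: vge_prod => k /andP[/vY[c_ge0 vYk] _].
exact: (vge_fbinom p_pr v_p).
Qed.

Lemma dval_binom_prod Y c d : digits_lt d ->
  (forall k, (1 <= k <= n)%N -> 0 < c k /\ v (Y k) = (- c k)%:E) ->
  v (binom_prod Y d) = (weight c d)%:E.
Proof.
move=> d_lt vY; rewrite weightE /binom_prod big_nat_cond.
apply: dval_prod => k /andP[/vY[c_gt0 vYk] _].
exact: (dval_fbinom p_pr v_p).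
Qed.

Lemma vge_binom_prodB Y z c d (e : int) : digits_lt d -> 0 <= e ->
  (forall k, (1 <= k <= n)%N ->
    [/\ 0 <= c k, vge v (- c k) (Y k) & vge v (- c k + e) (z k)]) ->
  vge v (weight c d + e)
    (binom_prod (fun k => Y k + z k) d - binom_prod Y d).
Proof.
move=> d_lt e_ge0 vYz; rewrite weightE /binom_prod.
rewrite big_nat_cond [X in vge _ _ (_ - X)]big_nat_cond.
apply: vge_prodB => k /andP[/vYz[c_ge0 vYk vzk] _].
split; try apply: (vge_fbinom p_pr v_p) => //.
  by apply: vgeD => //; apply: vgeW vzk; rewrite lerDl.
exact: (vge_fbinomB p_pr v_p).
Qed.

Lemma vge_lowered_prod Y c d i s : (1 <= i <= n)%N -> digits_lt d ->
  (forall k, (1 <= k <= n)%N -> 0 <= c k /\ vge v (- c k) (Y k)) ->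
  vge v (weight c d + c i *+ s) (lowered_prod Y d i s).
Proof.
move=> i_n d_lt vY; rewrite /lowered_prod; case: ifP => [le_s|_].
  rewrite -weight_sub //; apply: vge_binom_prod => //; exact: digits_lt_sub.
exact: vge0.
Qed.

Lemma binom_prod_shift Y d i (a : F) : (1 <= i <= n)%N -> digits_lt d ->
  binom_prod [eta Y with i |-> Y i + a%:A] d =
  \sum_(s < p) fbinom a s *: lowered_prod Y d i s.
Proof.
move=> i_n d_lt.
have splitD1 Y' d' : binom_prod Y' d' = fbinom (Y' i) (d' i) *
    \prod_(1 <= k < n.+1 | k != i) fbinom (Y' k) (d' k).
  by rewrite /binom_prod (bigD1_seq i) ?iota_uniq // mem_index_iota ltnS.
transitivity (\sum_(s < p | (s < (d i).+1)%N)
    fbinom a s *: lowered_prod Y d i s); last first.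
  rewrite big_mkcond; apply: eq_bigr => s _; rewrite /lowered_prod ltnS.
  by case: (s <= d i)%N; rewrite ?scaler0.
rewrite -(big_ord_widen _ (fun s => fbinom a s *: lowered_prod Y d i s)) //.
rewrite splitD1 /= eqxx (fbinom_addl (natr_neq0 p_pr v_p)) // mulr_suml.
apply: eq_bigr => s _; rewrite /lowered_prod -ltnS ltn_ord splitD1 /= eqxx.
rewrite -[RHS]mulr_algl [RHS]mulrA -[(fbinom a s)%:A]in_algE rmorph_fbinom.
by congr (_ * _); apply: eq_bigr => k /negPf ki; rewrite ki.
Qed.

Lemma binom_prod_pascal Y d i : (1 <= i <= n)%N -> digits_lt d ->
  binom_prod [eta Y with i |-> Y i + 1] d - binom_prod Y d =
  lowered_prod Y d i 1.
Proof.
move=> i_n d_lt; rewrite -[X in Y i + X]scale1r binom_prod_shift //.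
case: p p_pr => [|[|p']] // _; rewrite 2!big_ord_recl big1 => [|s _].
  by rewrite !fbinom1 !scale1r lowered_prod0 addr0 addrAC subrr add0r.
by rewrite fbinom1 scale0r.
Qed.

End BinomialProducts.

(** * Base-p digits and the index attached to a valuation *)

Definition scaffold_shift (p n : nat) (bb : nat -> int) (i : nat) : int :=
  (p ^ (n - i))%N%:Z * bb i.

Section Digits.
Variable p : nat.
Hypothesis p_gt0 : (0 < p)%N.

Lemma digit_lt a k : (digit p a k < p)%N.
Proof. by rewrite ltn_mod. Qed.

Lemma leq_digit a m : (0 < digit p a m)%N -> (p ^ m <= a)%N.
Proof.
by apply: contraTT; rewrite -ltnNge => lt_a; rewrite /digit divn_small ?mod0n.
Qed.

Lemma modn_sum_digits a n :
  (a %% p ^ n = \sum_(0 <= k < n) digit p a k * p ^ k)%N.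
Proof.
elim: n => [|n IHn]; first by rewrite modn1 big_geq.
rewrite big_nat_recr //= -IHn /digit.
have Ea : a = (a %/ p ^ n %/ p * p ^ n.+1 +
    (a %% p ^ n + a %/ p ^ n %% p * p ^ n))%N.
  by rewrite expnS mulnA [(_ %% _ + _)%N]addnC addnA -mulnDl -!divn_eq.
rewrite [in LHS]Ea modnMDl modn_small //.
have lt_r : (a %% p ^ n < p ^ n)%N by rewrite ltn_pmod // expn_gt0 p_gt0.
have lt_d := ltn_pmod (a %/ p ^ n) p_gt0.
rewrite expnS; apply: leq_trans (_ : (a %/ p ^ n %% p).+1 * p ^ n <= _)%N.
  by rewrite mulSn ltn_add2r.
by rewrite leq_mul2r lt_d orbT.
Qed.

Lemma digit_sub_exp a m k : (0 < digit p a m)%N ->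
  digit p (a - p ^ m) k = if k == m then (digit p a m).-1 else digit p a k.
Proof.
rewrite /digit; set Q := (p ^ m)%N.
have Q_gt0 : (0 < Q)%N by rewrite expn_gt0 p_gt0.
rewrite (divn_eq a Q); set x := (a %/ Q)%N; set r := (a %% Q)%N.
have lt_r : (r < Q)%N by rewrite ltn_mod.
rewrite divnMDl // (divn_small lt_r) addn0 => x_mod.
have x_gt0 : (0 < x)%N by case: (x) x_mod; rewrite ?mod0n.
have -> : (x * Q + r - Q = x.-1 * Q + r)%N.
  by rewrite -{1}(prednK x_gt0) mulSn -addnA addKn.
have Ex : x.-1 = ((x %/ p) * p + (x %% p).-1)%N.
  by rewrite {1}(divn_eq x p) -(prednK x_mod) addnS.
have lt_x : ((x %% p).-1 < p)%N.
  by apply: leq_ltn_trans (leq_pred _) _; rewrite ltn_mod.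
case: (ltngtP k m) => [km|mk|->].
- rewrite /Q -(subnK (ltnW km)) expnD !mulnA !divnMDl ?expn_gt0 ?p_gt0 //.
  rewrite -(prednK (_ : 0 < m - k)%N) ?subn_gt0 // expnSr !mulnA.
  by rewrite !modnMDl.
- rewrite /Q -(subnKC (ltnW mk)) expnD !divnMA -/Q !divnMDl //.
  rewrite (divn_small lt_r) !addn0 -(prednK (_ : 0 < k - m)%N) ?subn_gt0 //.
  by rewrite expnS !divnMA {1}Ex divnMDl // (divn_small lt_x) addn0.
by rewrite -/Q divnMDl // (divn_small lt_r) addn0 Ex modnMDl modn_small.
Qed.

Variable n : nat.

(* Numbered from the top, as in rho: position i holds the digit of p^(n-i).   *)
Definition digits (a i : nat) : nat := digit p a (n - i).

Lemma digitsP a : digits_lt p (digits a).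
Proof. by move=> i; apply: digit_lt. Qed.

Lemma sum_digits a : (a < p ^ n)%N ->
  a = (\sum_(1 <= i < n.+1) digits a i * p ^ (n - i))%N.
Proof.
move=> lt_a; rewrite -[LHS](modn_small lt_a) modn_sum_digits big_nat_rev.
by rewrite big_add1; apply: eq_bigr => i _.
Qed.

Lemma digits_sub_exp a i : (i <= n)%N -> (0 < digits a i)%N ->
  forall k, (1 <= k <= n)%N ->
  digits (a - p ^ (n - i)) k = [eta digits a with i |-> (digits a i - 1)%N] k.
Proof.
move=> i_n ai k k_n; rewrite /digits digit_sub_exp //= subn1.
by have -> : (n - k == n - i)%N = (k == i) by lia.
Qed.

Lemma weight_mod (bb : nat -> int) (b a : nat) :
  (forall i, (1 <= i <= n)%N -> (bb i = b %[mod (p ^ n)%N])%Z) ->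
  (a < p ^ n)%N ->
  ((p ^ n)%N %| weight n (scaffold_shift p n bb) (digits a) + a%:Z * b%:Z)%Z.
Proof.
move=> bb_b /sum_digits {2}->; rewrite /weight /scaffold_shift.
rewrite (big_morph Posz PoszD (erefl 0%:Z)) mulr_suml addrC -sumrB.
rewrite big_nat_cond; apply: rpred_sum => i /andP[/bb_b/eqP bi_b _].
set d := (digits a i); set q := (p ^ (n - i))%N%:Z.
have -> : (d * p ^ (n - i))%N%:Z * b%:Z - q * bb i *+ d =
    - (d%:Z * q) * (bb i - b%:Z) by rewrite PoszM; lia.
by apply: dvdz_mull; rewrite -eqz_mod_dvd.
Qed.

End Digits.

Section Index.
Variables (p n b : nat).
Hypotheses (p_gt0 : (0 < p)%N) (cop : coprime b (p ^ n)).
Local Notation N := (p ^ n)%N.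
Local Notation a := (frak_a p n b).

Let N_gt0 : (0 < N)%N. Proof. by rewrite expn_gt0 p_gt0. Qed.

Lemma frak_aE t : (a t)%:Z = ((- t * (egcdz b N).1) %% N)%Z.
Proof. by rewrite /frak_a gez0_abs // modz_ge0 // eqz_nat -lt0n. Qed.

Lemma frak_a_lt t : (a t < N)%N.
Proof. by rewrite -ltz_nat frak_aE ltz_pmod. Qed.

Lemma dvdz_mul_coprime (x : int) : (N %| x * b%:Z)%Z = (N %| x)%Z.
Proof. by rewrite Gauss_dvdzl // coprimezE coprime_sym. Qed.

Lemma dvdz_frak_a t : (N %| t + (a t)%:Z * b%:Z)%Z.
Proof.
have [u Eu] : exists w, (egcdz b N).1 * b%:Z + w * N%:Z = 1.
  case: egcdzP => u w Euw _; exists w; rewrite Euw.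
  by rewrite /gcdz /= (eqP cop).
set x := - t * (egcdz b N).1.
have -> : t + (a t)%:Z * b%:Z = (t * u - (x %/ N)%Z * b%:Z) * N%:Z.
  have -> : (a t)%:Z = x - (x %/ N)%Z * N%:Z by rewrite frak_aE.
  by rewrite /x -{1}[t]mulr1 -Eu; ring.
exact: dvdz_mull.
Qed.

Lemma frak_a_unique t x : (x < N)%N -> (N %| t + x%:Z * b%:Z)%Z -> a t = x.
Proof.
move=> lt_x dvd_x; have lt_a := frak_a_lt t.
have : (N %| ((a t)%:Z - x%:Z) * b%:Z)%Z.
  have -> : ((a t)%:Z - x%:Z) * b%:Z =
      t + (a t)%:Z * b%:Z - (t + x%:Z * b%:Z) by ring.
  by rewrite rpredB // dvdz_frak_a.
by rewrite dvdz_mul_coprime -eqz_mod_dvd !modz_small //= => /eqP[].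
Qed.

Lemma frak_a_period t : a (t + N%:Z) = a t.
Proof.
apply: frak_a_unique; first exact: frak_a_lt.
by rewrite addrAC rpredD ?dvdz_frak_a.
Qed.

Lemma frak_a_sub t m (x : int) : (p ^ m <= a t)%N -> (x = b %[mod N])%Z ->
  a (t + (p ^ m)%N%:Z * x) = (a t - p ^ m)%N.
Proof.
move=> le_a /eqP x_b; apply: frak_a_unique.
  exact: leq_ltn_trans (leq_subr _ _) (frak_a_lt t).
have -> : t + (p ^ m)%N%:Z * x + (a t - p ^ m)%N%:Z * b%:Z =
    t + (a t)%:Z * b%:Z + (p ^ m)%N%:Z * (x - b%:Z) by rewrite -subzn //; ring.
by rewrite rpredD ?dvdz_frak_a // dvdz_mull // -eqz_mod_dvd.
Qed.

End Index.

Section Lambda.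
Variables (p n b : nat) (F : fieldType) (L : splittingFieldType F).
Variables (v0 : discrete_valuation F) (v : discrete_valuation L).
Variables (X : nat -> L) (pi0 : F) (w : nat -> int).
Local Notation N := (p ^ n)%N.
Local Notation a := (frak_a p n b).
Local Notation lam := (lambda v p n b X pi0).
Hypotheses (p_gt0 : (0 < p)%N) (cop : coprime b N).
Hypotheses (ram : has_ram_index v0 v N) (v_pi0 : v0 pi0 = 1%:E).
Hypothesis v_rho : forall x, v (rho p n X x) = (w x)%:E.
Hypothesis w_mod : forall x, (x < N)%N -> (N %| w x + x%:Z * b%:Z)%Z.

Definition lambda_exponent t : int := ((t - w (a t)) %/ N)%Z.

Lemma lambdaE t : lam t = pi0 ^ lambda_exponent t *: rho p n X (a t).
Proof. by rewrite /lambda v_rho. Qed.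

Lemma lambda_exponentK t : N%:Z * lambda_exponent t = t - w (a t).
Proof.
rewrite mulrC; apply/eqP; rewrite -dvdz_eq.
have -> : t - w (a t) =
    t + (a t)%:Z * b%:Z - (w (a t) + (a t)%:Z * b%:Z) by ring.
by rewrite rpredB ?dvdz_frak_a // w_mod // frak_a_lt.
Qed.

Lemma dval_lambda_coef t :
  v (pi0 ^ lambda_exponent t)%:A = (t - w (a t))%:E.
Proof.
by rewrite (dval_alg ram (dval_exprz _ v_pi0)) mul1r lambda_exponentK.
Qed.

Lemma dval_lambda t : v (lam t) = t%:E.
Proof.
by rewrite lambdaE -mulr_algl dvalM dval_lambda_coef v_rho -EFinD subrK.
Qed.

Lemma lambda_period t : lam (t + N%:Z) = pi0 *: lam t.
Proof.
rewrite !lambdaE /lambda_exponent frak_a_period //.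
have -> : t + N%:Z - w (a t) = 1 * N%:Z + (t - w (a t)) by ring.
rewrite divzMDl; last by rewrite eqz_nat -lt0n expn_gt0 p_gt0.
by rewrite expfzDr ?(dval_neq0 v_pi0) // scalerA.
Qed.

Lemma lambda_addr t m : w (a (t + m)) = w (a t) + m ->
  lam (t + m) = pi0 ^ lambda_exponent t *: rho p n X (a (t + m)).
Proof.
by move=> w_m; rewrite lambdaE /lambda_exponent w_m opprD addrACA subrr addr0.
Qed.

End Lambda.

(** * The inductive estimate *)

Definition excess (p n : nat) (bb : nat -> int) (i : nat) : int :=
  (p%:Z - 1) * \sum_(1 <= k < i) (p ^ (n - k - 1))%N%:Z * bb k.

Definition precision (p n : nat) (bb : nat -> int) (T i : nat) : int :=
  scaffold_shift p n bb i + excess p n bb i + T%:Z.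

(* The choices of the theorem, with all valuations read off in the top field. *)
Record scaffold_choice (p n b : nat) (F : fieldType) (L : splittingFieldType F)
    (v : discrete_valuation L) (bb : nat -> int) (sigma : nat -> gal_of {:L})
    (X : nat -> L) (mu : nat -> nat -> F) (eps : nat -> nat -> L) (T : nat) :
    Prop := ScaffoldChoice {
  coprime_b : coprime b (p ^ n);
  bb_mod : forall i, (1 <= i <= n)%N -> (bb i = b %[mod (p ^ n)%N])%Z;
  bb_gt0 : forall i, (1 <= i <= n)%N -> 0 < bb i;
  bb_le : forall i j, (1 <= i <= j)%N -> (j <= n)%N -> bb i <= bb j;
  dval_X : forall j, (1 <= j <= n)%N ->
    v (X j) = (- scaffold_shift p n bb j)%:E;
  dval_mu : forall i j, (1 <= i <= j)%N -> (j <= n)%N ->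
    v (mu i j)%:A = ((p ^ (n - j))%N%:Z * (bb i - bb j))%:E;
  mu_diag : forall j, (1 <= j <= n)%N -> mu j j = 1;
  sigma_X : forall i j, (1 <= i <= j)%N -> (j <= n)%N ->
    sigma i (X j) = X j + (mu i j)%:A + eps i j;
  sigma_X_fix : forall i j, (1 <= j < i)%N -> (i <= n)%N ->
    sigma i (X j) = X j;
  vge_eps : forall i j, (1 <= i <= j)%N -> (j <= n)%N ->
    vge v (- scaffold_shift p n bb j + precision p n bb T i) (eps i j)
}.

Section Scaffold.
Variables (p n b : nat) (F : fieldType) (L : splittingFieldType F).
Variables (v0 : discrete_valuation F) (v : discrete_valuation L).
Variables (bb : nat -> int) (sigma : nat -> gal_of {:L}) (X : nat -> L).
Variables (mu : nat -> nat -> F) (eps : nat -> nat -> L) (T : nat).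
Variable Theta : nat -> gal_ring L.

Local Notation q k := ((p ^ (n - k))%N%:Z).
Local Notation c := (scaffold_shift p n bb).
Local Notation exc := (excess p n bb).
Local Notation prec := (precision p n bb T).
Local Notation R := (binom_prod n).
Local Notation wt := (weight n c).

Definition trunc_exp_prod i k : gal_ring L :=
  \prod_(l < k) trunc_exp p (Theta (n - l)%N) (- mu i (n - l)%N).

Hypothesis p_pr : prime p.
Hypothesis Theta_def : forall i, (1 <= i <= n)%N ->
  Theta i = gr_of (sigma i) * trunc_exp_prod i (n - i)%N.

Lemma Psi_fix1 i : (1 <= i <= n)%N -> gr_act (Theta i - 1) 1 = 0.
Proof.
have [m] := ubnP (n - i)%N; elim: m i => // m IHm i lt_m i_n.
rewrite gr_act_sub1 Theta_def // gr_actM gr_act_of.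
rewrite (gr_act_prod_fix1
  (f := fun l => trunc_exp p (Theta (n - l)%N) (- mu i (n - l)%N))).
  by rewrite rmorph1 subrr.
move=> l l_n; apply: gr_act_trunc_exp_fix1; first exact: prime_gt0.
by apply: IHm; lia.
Qed.

Hypothesis choice : scaffold_choice p n b v bb sigma X mu eps T.

Lemma scaffold_shift_gt0 i : (1 <= i <= n)%N -> 0 < c i.
Proof.
by move=> /(bb_gt0 choice) bi; rewrite mulr_gt0 // ltz_nat expn_gt0 prime_gt0.
Qed.

Lemma excess_ge0 i : (i <= n.+1)%N -> 0 <= exc i.
Proof.
move=> i_n; apply: mulr_ge0; first by have := prime_gt0 p_pr; lia.
rewrite big_nat_cond; apply: sumr_ge0 => k /andP[/andP[k_gt0 ki] _].
by rewrite mulr_ge0 // ltW // (bb_gt0 choice) //; lia.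
Qed.

Lemma excess_mono i j : (1 <= i <= j)%N -> (j <= n)%N ->
  c i + exc i <= q j * bb i + exc j.
Proof.
case/andP=> i_gt0; elim: j => [|j IHj]; first by rewrite leqn0 => /eqP->.
rewrite leq_eqVlt => /predU1P[->//|]; rewrite ltnS => le_ij lt_jn.
apply: le_trans (IHj le_ij (ltnW lt_jn)) _.
rewrite /excess big_nat_recr /=; last exact: leq_trans le_ij.
have -> : (n - j = (n - j.+1).+1)%N by rewrite subnSK.
rewrite subn1 /= expnS; set Q := (p ^ _)%N.
have le_b : bb i <= bb j by apply: (bb_le choice); rewrite ?i_gt0 // ltnW.
rewrite mulrDr; have := prime_gt0 p_pr; move: (_ * bigop _ _ _) => S.
rewrite PoszM => p_gt0.
have : 0 <= (p%:Z - 1) * Q%:Z * (bb j - bb i).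
  by rewrite !mulr_ge0 // ?subr_ge0 //; lia.
nia.
Qed.

Hypotheses (totram : totally_ramified v0 v) (v_p : vge v 1 p%:R).
Hypothesis dimL : \dim {:L} = (p ^ n)%N.

Let ram : has_ram_index v0 v (p ^ n)%N.
Proof. by rewrite -dimL. Qed.

Lemma dval_rho a : v (rho p n X a) = (wt (digits p n a))%:E.
Proof.
apply: (dval_binom_prod p_pr v_p) => [|k k_n].
  exact: digitsP (prime_gt0 p_pr) _ _.
by split; [apply: scaffold_shift_gt0 | apply: (dval_X choice)].
Qed.

Lemma weight_digits_mod a : (a < p ^ n)%N ->
  ((p ^ n)%N %| wt (digits p n a) + a%:Z * b%:Z)%Z.
Proof. exact: (weight_mod (prime_gt0 p_pr) (bb_mod choice)). Qed.

Lemma vge_linear_binom_prod (f : {linear L -> L}) (m : int) :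
  (forall d, digits_lt p d -> vge v (wt d + m) (f (R X d))) ->
  forall l x, vge v l x -> vge v (l + m) (f x).
Proof.
move=> vf; apply: (vge_linear (r := fun a : 'I_(p ^ n) => wt (digits p n a))
  (e := fun a => rho p n X a) ram _ dimL) => [|a]; last first.
  exact/vf/digitsP/prime_gt0.
split=> [a|a a' /eqP]; first exact: dval_rho.
rewrite eqz_mod_dvd => dvd_w; apply/ord_inj/eqP; rewrite -eqz_nat.
have : ((p ^ n)%N %| (a%:Z - a'%:Z) * b%:Z)%Z.
  have -> : (a%:Z - a'%:Z) * b%:Z = (wt (digits p n a) + a%:Z * b%:Z)
     - (wt (digits p n a') + a'%:Z * b%:Z)
     - (wt (digits p n a) - wt (digits p n a')) by ring.
  by apply: rpredB => //; apply: rpredB; apply: weight_digits_mod.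
rewrite (dvdz_mul_coprime (coprime_b choice)) -eqz_mod_dvd.
by rewrite !modz_small ?ltz_nat /=.
Qed.

(* Psi_j^s gains s * c_j, so the bounds on mu_(i,j) leave a net gain of       *)
(* s * p^(n-j) * b_i in the s-th term of Theta_j^[-mu_(i,j)].                 *)
Lemma vge_binom_muZ i j s m x : (1 <= i < j)%N -> (j <= n)%N -> (s < p)%N ->
  vge v (m + c j *+ s) x ->
  vge v (m + (q j * bb i) *+ s) (fbinom (- mu i j) s *: x).
Proof.
move=> ij j_n s_p vx.
have vb : vge v (- ((q j * (bb j - bb i)) *+ s)) (fbinom (- mu i j) s)%:A.
  rewrite -in_algE rmorph_fbinom; apply: (vge_fbinom p_pr v_p) => //.
    by rewrite mulr_ge0 // subr_ge0 (bb_le choice) //; lia.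
  rewrite rmorphN vgeN -mulrN opprB; apply/dval_vge/(dval_mu choice) => //; lia.
rewrite -mulr_algl; apply: vgeW (vgeM vb vx).
by rewrite /scaffold_shift mulrBr mulrnBl; lia.
Qed.

Let muZ_gain_ge0 i j s : (1 <= i < j)%N -> (j <= n)%N ->
  0 <= (q j * bb i) *+ s.
Proof.
move=> ij j_n; rewrite mulrn_wge0 // mulr_ge0 // ltW // (bb_gt0 choice) //.
lia.
Qed.

Let vge_X k : (1 <= k <= n)%N -> 0 <= c k /\ vge v (- c k) (X k).
Proof.
move=> k_n; split; first exact/ltW/scaffold_shift_gt0.
exact/dval_vge/(dval_X choice).
Qed.

Definition Psi_lowers i := forall d, digits_lt p d ->
  vge v (wt d + prec i)
    (gr_act (Theta i - 1) (R X d) - lowered_prod n X d i 1).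

Lemma vge_Psi j : (1 <= j <= n)%N -> Psi_lowers j -> forall l x,
  vge v l x -> vge v (l + c j) (gr_act (Theta j - 1) x).
Proof.
move=> j_n lowers_j; apply: vge_linear_binom_prod => d d_lt /=.
rewrite -[gr_act _ _](subrK (lowered_prod n X d j 1)); apply: vgeD.
  apply: vgeW (lowers_j d d_lt).
  rewrite lerD2l /precision -addrA lerDl addr_ge0 //.
  by apply: excess_ge0; lia.
by have := vge_lowered_prod p_pr v_p 1 j_n d_lt vge_X.
Qed.

Lemma vge_PsiX j s : (1 <= j <= n)%N -> Psi_lowers j -> forall l x,
  vge v l x -> vge v (l + c j *+ s) (gr_act ((Theta j - 1) ^+ s) x).
Proof.
move=> j_n lowers_j l x vx; elim: s => [|s IHs].
  by rewrite gr_act1l addr0.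
by rewrite exprS gr_actM mulrSr addrA; apply: vge_Psi.
Qed.

Lemma PsiX_lowers j s d : (1 <= j <= n)%N -> Psi_lowers j -> digits_lt p d ->
  vge v (wt d + c j *+ s + (exc j + T%:Z))
    (gr_act ((Theta j - 1) ^+ s) (R X d) - lowered_prod n X d j s).
Proof.
move=> j_n lowers_j d_lt; elim: s => [|s IHs].
  by rewrite gr_act1l lowered_prod0 subrr vge0.
rewrite exprS gr_actM mulrSr.
apply: (vgeB_trans (y := gr_act (Theta j - 1) (lowered_prod n X d j s))).
  by rewrite -linearB /=; apply: vgeW (vge_Psi j_n lowers_j IHs); lia.
have [s_d|d_s] := leqP s (d j); last first.
  rewrite /lowered_prod (ltn_geF d_s) (ltn_geF (leqW d_s)) linear0 subrr.
  exact: vge0.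
have := lowers_j _ (digits_lt_sub j s d_lt).
rewrite lowered_prodS // weight_sub // {2}/lowered_prod s_d.
by apply: vgeW; rewrite /precision; lia.
Qed.

Lemma trunc_exp_lowers i j d : (1 <= i < j)%N -> (j <= n)%N ->
  Psi_lowers j -> digits_lt p d ->
  vge v (wt d + prec i) (gr_act (trunc_exp p (Theta j) (- mu i j)) (R X d) -
    \sum_(s < p) fbinom (- mu i j) s *: lowered_prod n X d j s).
Proof.
move=> ij j_n lowers_j d_lt; have j_n' : (1 <= j <= n)%N by lia.
rewrite gr_act_trunc_exp -sumrB; apply: vge_sum => s _; rewrite -scalerBr.
case: (posnP s) => [->|s_gt0].
  by rewrite gr_act1l lowered_prod0 subrr scaler0 vge0.
have := PsiX_lowers s j_n' lowers_j d_lt.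
rewrite addrAC => /(vge_binom_muZ ij j_n (ltn_ord s)); apply: vgeW.
have : c i + exc i <= q j * bb i + exc j by apply: excess_mono; lia.
rewrite -(prednK s_gt0) mulrSr /precision.
have := muZ_gain_ge0 s.-1 ij j_n; lia.
Qed.

Lemma vge_trunc_exp i j : (1 <= i < j)%N -> (j <= n)%N -> Psi_lowers j ->
  forall l x, vge v l x ->
  vge v l (gr_act (trunc_exp p (Theta j) (- mu i j)) x).
Proof.
move=> ij j_n lowers_j l x vx; rewrite gr_act_trunc_exp; apply: vge_sum => s _.
have j_n' : (1 <= j <= n)%N by lia.
have /(vge_binom_muZ ij j_n (ltn_ord s)) := vge_PsiX s j_n' lowers_j vx.
by apply: vgeW; rewrite lerDl muZ_gain_ge0.
Qed.

Lemma trunc_exp_prodS i k x : gr_act (trunc_exp_prod i k.+1) x =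
  gr_act (trunc_exp_prod i k)
    (gr_act (trunc_exp p (Theta (n - k)%N) (- mu i (n - k)%N)) x).
Proof. by rewrite /trunc_exp_prod big_ord_recr gr_actM. Qed.

Lemma vge_trunc_exp_prod i k : (1 <= i)%N -> (k <= n - i)%N ->
  (forall j, (i < j <= n)%N -> Psi_lowers j) ->
  forall l x, vge v l x -> vge v l (gr_act (trunc_exp_prod i k) x).
Proof.
move=> i_gt0 k_n lowers_gt; elim: k k_n => [|k IHk] k_n l x vx.
  by rewrite /trunc_exp_prod big_ord0 gr_act1l.
rewrite trunc_exp_prodS; apply: IHk; first exact: ltnW.
by apply: vge_trunc_exp vx; [lia | lia | apply: lowers_gt; lia].
Qed.

Definition shifted_X i m : nat -> L :=
  fun k => if (m < k)%N then X k + (- mu i k)%:A else X k.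

Lemma binom_prod_shifted_X i j d : (1 <= j <= n)%N -> digits_lt p d ->
  R (shifted_X i j.-1) d =
  \sum_(s < p) fbinom (- mu i j) s *: lowered_prod n (shifted_X i j) d j s.
Proof.
move=> j_n d_lt; rewrite -(binom_prod_shift p_pr v_p) //.
apply: eq_binom_prod => k k_n; split=> //=; rewrite /shifted_X ltnn.
have -> : (j.-1 < k)%N = (k == j) || (j < k)%N by lia.
by case: eqVneq => [->|].
Qed.

(* Peeling off the rightmost factor first: it sends a product of binomials in *)
(* X to a combination of such products up to the error, so the induction      *)
(* hypothesis applies to the remaining factors.                               *)
Lemma trunc_exp_prod_shifts i k d : (1 <= i)%N -> (k <= n - i)%N ->
  (forall j, (i < j <= n)%N -> Psi_lowers j) -> digits_lt p d ->
  vge v (wt d + prec i)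
    (gr_act (trunc_exp_prod i k) (R X d) - R (shifted_X i (n - k)%N) d).
Proof.
move=> i_gt0 k_n lowers_gt; elim: k k_n d => [|k IHk] k_n d d_lt.
  rewrite /trunc_exp_prod big_ord0 gr_act1l (_ : R (shifted_X _ _) d = R X d).
    by rewrite subrr vge0.
  apply: eq_binom_prod => j /andP[_ j_n].
  by rewrite /shifted_X ltnNge subn0 j_n.
rewrite trunc_exp_prodS subnS; set j := (n - k)%N.
have [ij j_n j_n'] : [/\ (1 <= i < j)%N, (j <= n)%N & (1 <= j <= n)%N].
  by rewrite /j; split; lia.
apply: (vgeB_trans (y := gr_act (trunc_exp_prod i k)
    (\sum_(s < p) fbinom (- mu i j) s *: lowered_prod n X d j s))).
  rewrite -linearB; apply: vge_trunc_exp_prod => //; first exact: ltnW.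
  by apply: trunc_exp_lowers => //; apply: lowers_gt; lia.
rewrite binom_prod_shifted_X // linear_sum -sumrB; apply: vge_sum => s _.
rewrite linearZ -scalerBr.
have lowered_shift : vge v (wt d + prec i + c j *+ s)
    (gr_act (trunc_exp_prod i k) (lowered_prod n X d j s) -
     lowered_prod n (shifted_X i j) d j s).
  rewrite /lowered_prod; case: ifP => [s_d|_]; last first.
    by rewrite linear0 subrr vge0.
  rewrite addrAC -weight_sub //.
  exact: IHk (ltnW k_n) _ (digits_lt_sub _ _ _).
apply: vgeW (vge_binom_muZ ij j_n (ltn_ord s) lowered_shift).
by rewrite lerDl muZ_gain_ge0.
Qed.

Lemma sigma_shifted_X i k : (1 <= i <= n)%N -> (1 <= k <= n)%N ->
  sigma i (shifted_X i i k) =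
  [eta X with i |-> X i + 1] k + (if (k < i)%N then 0 else eps i k).
Proof.
move=> /andP[i_gt0 i_n] /andP[k_gt0 k_n]; rewrite /shifted_X /=.
case: (ltngtP k i) => [ki|ik|->].
- by rewrite addr0 (sigma_X_fix choice) ?k_gt0.
- rewrite rmorphD /= (sigma_X choice) ?i_gt0 ?(ltnW ik) //.
  by rewrite linearZ /= rmorph1 scaleNr; ring.
by rewrite (sigma_X choice) ?i_gt0 ?leqnn // (mu_diag choice) ?i_gt0 // scale1r.
Qed.

Lemma Psi_lowers_step i : (1 <= i <= n)%N ->
  (forall j, (i < j <= n)%N -> Psi_lowers j) -> Psi_lowers i.
Proof.
move=> i_n lowers_gt d d_lt; have [i_gt0 i_le] := andP i_n.
have prec_ge0 : 0 <= prec i.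
  apply: addr_ge0 => //; apply: addr_ge0; first exact/ltW/scaffold_shift_gt0.
  exact/excess_ge0/leqW.
have := trunc_exp_prod_shifts i_gt0 (leqnn _) lowers_gt d_lt.
rewrite subKn // -(vge_gal totram (sigma i)) linearB /= gal_binom_prod => vE.
rewrite gr_act_sub1 Theta_def // gr_actM gr_act_of.
rewrite -(binom_prod_pascal p_pr v_p) // opprB [X in vge _ _ X]addrA subrK.
apply: vgeB_trans vE _.
rewrite (eq_binom_prod (Y' := fun k => [eta X with i |-> X i + 1] k +
  (if (k < i)%N then 0 else eps i k)) (d' := d)); last first.
  by move=> k k_n; rewrite /= sigma_shifted_X.
apply: (vge_binom_prodB p_pr v_p) => // k k_n; have [ck vXk] := vge_X k_n.
split=> //=.
- case: eqP => [Ek|_] //; apply: vgeD; first by rewrite -Ek.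
  by apply: vgeW (dval_vge (dval1 v)); rewrite oppr_le0.
case: ltnP => [_|ik]; first exact: vge0.
by apply: (vge_eps choice); rewrite ?i_gt0 //; case/andP: k_n.
Qed.

Lemma Psi_lowers_all i : (1 <= i <= n)%N -> Psi_lowers i.
Proof.
have [m] := ubnP (n - i)%N; elim: m i => // m IHm i lt_m i_n.
by apply: Psi_lowers_step => // j j_n; apply: IHm; lia.
Qed.

Section Congruence.
Variable pi0 : F.
Hypothesis v_pi0 : v0 pi0 = 1%:E.
Local Notation a := (frak_a p n b).
Local Notation lam := (lambda v p n b X pi0).
Local Notation f := (lambda_exponent p n b (fun a => wt (digits p n a))).

Let p_gt0 := prime_gt0 p_pr.

Lemma dval_scaffold_lambda t : v (lam t) = t%:E.
Proof.
exact: (dval_lambda p_gt0 (coprime_b choice) ram v_pi0 dval_rho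
  weight_digits_mod).
Qed.

Lemma scaffold_lambda_period t : lam (t + (p ^ n)%N%:Z) = pi0 *: lam t.
Proof. exact: (lambda_period p_gt0 (coprime_b choice) v_pi0 dval_rho). Qed.

Lemma lambda_lowered i t : (1 <= i <= n)%N -> (0 < digits p n (a t) i)%N ->
  lam (t + c i) = pi0 ^ f t *: lowered_prod n X (digits p n (a t)) i 1.
Proof.
move=> i_n dig_gt0; have [_ i_le] := andP i_n.
have Ea : a (t + c i) = (a t - p ^ (n - i))%N.
  apply: frak_a_sub (coprime_b choice) _ _ _ _ _ => //; first exact: leq_digit.
  exact: (bb_mod choice).
have dig_a := digits_sub_exp p_gt0 i_le dig_gt0; rewrite -Ea in dig_a.
rewrite (lambda_addr _ dval_rho).
  rewrite /lowered_prod dig_gt0; congr (_ *: _).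
  by apply: eq_binom_prod => k k_n; split=> //; apply: dig_a.
by rewrite (eq_weight _ dig_a) weight_sub.
Qed.

Lemma Psi_lambda i t : (1 <= i <= n)%N ->
  lcong v (lam (t + c i)) T (gr_act (Theta i - 1) (lam t))
    (if (1 <= digit p (a t) (n - i))%N then lam (t + c i) else 0).
Proof.
move=> i_n; have [_ i_le] := andP i_n; set d := digits p n (a t).
have -> : (if (1 <= digit p (a t) (n - i))%N then lam (t + c i) else 0) =
    pi0 ^ f t *: lowered_prod n X d i 1.
  case: ifP => [/(lambda_lowered i_n)//|no_digit].
  by rewrite /lowered_prod no_digit scaler0.
apply: lcong_vge (dval_scaffold_lambda _) _.
rewrite (lambdaE _ _ dval_rho) linearZ -scalerBr /= -mulr_algl.
have vf := dval_lambda_coef p_gt0 (coprime_b choice) ram v_pi0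
  weight_digits_mod t.
apply: vgeW (vgeM (dval_vge vf) (Psi_lowers_all i_n (digitsP p_gt0 _ _))).
have := excess_ge0 (leqW i_le); rewrite /precision -/d; lia.
Qed.

End Congruence.
End Scaffold.

(** * Ramification numbers along a chain of subgroups *)

Section SubgroupChain.
Variables (gT : finGroupType) (n : nat) (H : nat -> {group gT}).
Hypothesis H_normal : forall i, (1 <= i <= n)%N -> (H i <| H i.-1)%g.

Lemma chain_sub i j : (i <= j <= n)%N -> H j \subset H i.
Proof.
case/andP; elim: j => [|j IHj]; first by rewrite leqn0 => /eqP->.
rewrite leq_eqVlt => /predU1P[-> //|]; rewrite ltnS => ij j_n.
apply: subset_trans (IHj ij (ltnW j_n)).
by apply/normal_sub/(H_normal (i := j.+1)).
Qed.

Lemma chain_card p i : (0 < p)%N -> H n :=: 1%g ->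
  (forall k, (1 <= k <= n)%N -> (H k.-1 / H k \isog Zp p)%g) ->
  (i <= n)%N -> #|H i| = (p ^ (n - i))%N.
Proof.
move=> p_gt0 H_n H_quo i_n; rewrite -{1}(subKn i_n); have := leq_subr i n.
elim: (n - i)%N => [|k IHk] k_n; first by rewrite subn0 H_n cards1.
have k_n' : (1 <= n - k <= n)%N by rewrite subn_gt0 k_n leq_subr.
have [subH normH] := andP (H_normal k_n'); have := card_isog (H_quo _ k_n').
rewrite card_quotient // card_Zp // => index_p.
by rewrite subnS -(Lagrange subH) index_p IHk ?(ltnW k_n) // expnSr.
Qed.

End SubgroupChain.

Section RamificationNumbers.
Variables (F : fieldType) (L : splittingFieldType F).
Variables (v0 : discrete_valuation F) (v : discrete_valuation L).
Hypothesis totram : totally_ramified v0 v.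
Variable pi : L.
Hypothesis v_pi : v pi = 1%:E.
Implicit Type s : gal_of {:L}.

Lemma dval_ram_number s : s != 1%g ->
  v (s pi - pi) = (ram_number v pi s + 1)%:E.
Proof.
move=> s_neq1; rewrite /ram_number subrK; apply: dval_fineK.
rewrite subr_eq0; apply: contra s_neq1 => /eqP.
by move/(gal_uniformizer_inj totram v_pi)->.
Qed.

Lemma ram_number_ge0 s : s != 1%g -> 0 <= ram_number v pi s.
Proof.
move=> s_neq1; have : vge v 1 (s pi - pi).
  by apply: vgeB; rewrite ?(vge_gal totram); apply: dval_vge.
by rewrite /vge dval_ram_number // lee_fin lerDr.
Qed.

Lemma ram_number_gt0 s p n b : s != 1%g -> (1 < p ^ n)%N -> coprime b (p ^ n) ->
  (ram_number v pi s = b %[mod (p ^ n)%N])%Z -> 0 < ram_number v pi s.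
Proof.
move=> s_neq1 N_gt1 cop /eqP; rewrite lt_neqAle ram_number_ge0 // andbT.
apply: contraTneq => <-; rewrite eqz_mod_dvd sub0r rpredN dvdzE /=.
apply/negP => /gcdn_idPr gcd_b.
by move: cop N_gt1; rewrite /coprime gcd_b => /eqP->.
Qed.

Lemma mem_ramification_group s t : s != 1%g ->
  (s \in ramification_group v pi t) = (t <= ram_number v pi s).
Proof.
move=> s_neq1; rewrite inE dval_ram_number // lee_fin lerD2r gal_kHom ?sub1v //.
by rewrite k1AHom.
Qed.

Lemma ram_number_chain_le n (H : nat -> {group gal_of {:L}}) i s s' :
  (forall j k, (j <= k <= n)%N -> H k \subset H j) ->
  (forall t, exists2 k, (k <= n)%N & ramification_group v pi t = H k) ->
  (i <= n)%N -> s \notin H i -> s' \in H i.-1 -> s' != 1%g ->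
  ram_number v pi s <= ram_number v pi s'.
Proof.
move=> H_sub H_ram i_n s_H s'_H s'_neq1.
have s_neq1 : s != 1%g by apply: contraNneq s_H => ->; apply: group1.
have [k k_n Ek] := H_ram (ram_number v pi s).
have s_k : s \in H k by rewrite -Ek mem_ramification_group.
have lt_ki : (k < i)%N.
  rewrite ltnNge; apply: contra s_H => le_ik.
  by apply: subsetP s_k; rewrite H_sub ?le_ik.
rewrite -mem_ramification_group // Ek; apply: subsetP s'_H.
by rewrite H_sub //; lia.
Qed.

End RamificationNumbers.

Lemma coprime_modz_exp p n (b : nat) (x : int) : prime p -> ~~ (p %| x)%Z ->
  ((0 < n)%N -> (x = b %[mod (p ^ n)%N])%Z) -> coprime b (p ^ n).
Proof.
move=> p_pr; case: (posnP n) => [->|n_gt0]; first by rewrite coprimen1.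
move=> p_x /(_ isT)/eqP; rewrite eqz_mod_dvd => dvd_N.
rewrite coprime_sym coprimeXl // prime_coprime //; apply: contra p_x => p_b.
rewrite -(subrK b%:Z x) rpredD //; apply: dvdz_trans dvd_N.
by rewrite dvdzE /= dvdn_exp.
Qed.

Section FiltrationChoice.
Variables (p n b : nat) (F : fieldType) (L : splittingFieldType F).
Variables (v0 : discrete_valuation F) (vL : discrete_valuation L).
Variables (pi : L) (H : nat -> {group gal_of {:L}}).
Variable sigma : nat -> gal_of {:L}.
Variables (v : nat -> L -> \bar int) (X : nat -> L) (mu : nat -> nat -> F).
Variables (eps : nat -> nat -> L) (T : nat).
Local Notation bb i := (ram_number vL pi (sigma i)).

Hypotheses (p_pr : prime p) (totram : totally_ramified v0 vL).
Hypothesis v_pi : vL pi = 1%:E.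
Hypothesis H_n : H n :=: 1%g.
Hypothesis H_normal : forall i, (1 <= i <= n)%N -> (H i <| H i.-1)%g.
Hypothesis H_quo : forall i, (1 <= i <= n)%N -> (H i.-1 / H i \isog Zp p)%g.
Hypothesis H_ram : forall t : int,
  exists2 i, (i <= n)%N & ramification_group vL pi t = H i.
Hypothesis sigma_H : forall i, (1 <= i <= n)%N ->
  sigma i \in (H i.-1 :\: H i)%g.
Hypothesis v_norm : forall i, (i <= n)%N ->
  normalized_on vL (fixedField (H i)) (v i).
Hypothesis p_ndvd_bb1 : ~~ (p %| bb 1%N)%Z.
Hypothesis bb_b : forall i, (1 <= i <= n)%N ->
  (bb i = b %[mod (p ^ n)%N])%Z.
Hypothesis X_P : forall j, (1 <= j <= n)%N ->
  [/\ X j \in fixedField (H j), v j (X j) = (- bb j)%:E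
    & (0 < v j (sigma j (X j) - X j - 1)%R)%E].
Hypothesis mu_eps_P : forall i j, (1 <= i < j)%N -> (j <= n)%N ->
  [/\ sigma i (X j) - X j = (mu i j)%:A + eps i j, eps i j \in fixedField (H j),
      v j (mu i j)%:A = (bb i - bb j)%:E
    & ((bb i - bb j)%:E < v j (eps i j))%E].
Hypothesis mu_eps_diag : forall j, (1 <= j <= n)%N ->
  mu j j = 1 /\ eps j j = sigma j (X j) - X j - 1.
Hypothesis eps_bound : forall i j, (1 <= i <= j)%N -> (j <= n)%N ->
  (((p%:Z - 1) * (\sum_(1 <= k < i) (p ^ (n - k - 1))%N%:Z * bb k)
      + ((p ^ (n - i))%N%:Z - (p ^ (n - j))%N%:Z) * bb i + T%:Z)%:E
    <= vL (eps i j) - vL (mu i j)%:A)%E.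

Lemma dval_fixedField_chain j x : (j <= n)%N -> x \in fixedField (H j) ->
  vL x = ((p ^ (n - j))%N%:Z%:E * v j x)%E.
Proof.
move=> j_n xH; rewrite (normalized_on_fixedField totram (v_norm j_n) xH).
by rewrite (chain_card H_normal (prime_gt0 p_pr) H_n H_quo).
Qed.

Lemma sigma_neq1 i : (1 <= i <= n)%N -> sigma i != 1%g.
Proof. by case/sigma_H/setDP=> _; apply: contraNneq => ->; apply: group1. Qed.

Lemma dval_X_chain j : (1 <= j <= n)%N ->
  vL (X j) = (- scaffold_shift p n (fun i => bb i) j)%:E.
Proof.
move=> j_n; have [XH vX _] := X_P j_n; have [_ j_le] := andP j_n.
by rewrite (dval_fixedField_chain j_le XH) vX -EFinM mulrN.
Qed.

Lemma dval_mu_chain i j : (1 <= i <= j)%N -> (j <= n)%N ->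
  vL (mu i j)%:A = ((p ^ (n - j))%N%:Z * (bb i - bb j))%:E.
Proof.
move=> ij j_n; have [->|ne_ij] := eqVneq i j.
  by have [|-> _] := @mu_eps_diag j; [lia | rewrite scale1r dval1 subrr mulr0].
have [|_ _ vmu _] := mu_eps_P (i := i) (j := j) _ j_n; first by lia.
by rewrite (dval_fixedField_chain j_n) ?vmu // rpredZ ?rpred1.
Qed.

Lemma sigma_X_chain i j : (1 <= i <= j)%N -> (j <= n)%N ->
  sigma i (X j) = X j + (mu i j)%:A + eps i j.
Proof.
move=> ij j_n; have [->|ne_ij] := eqVneq i j.
  by have [|-> ->] := @mu_eps_diag j; [lia | rewrite scale1r; ring].
have [|E _ _ _] := mu_eps_P (i := i) (j := j) _ j_n; first by lia.
by rewrite -addrA -E addrC subrK.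
Qed.

Lemma sigma_X_fix_chain i j : (1 <= j < i)%N -> (i <= n)%N ->
  sigma i (X j) = X j.
Proof.
move=> ji i_n; have [|/mem_fixedFieldP[_ fixX] _ _] := @X_P j; first by lia.
have [|si _] := setDP (@sigma_H i _); first by lia.
by apply: fixX; apply: (subsetP (chain_sub H_normal _)) si; lia.
Qed.

Lemma vge_eps_chain i j : (1 <= i <= j)%N -> (j <= n)%N ->
  vge vL (- scaffold_shift p n (fun i => bb i) j +
          precision p n (fun i => bb i) T i) (eps i j).
Proof.
move=> ij j_n; have := eps_bound ij j_n; rewrite dval_mu_chain //.
rewrite /vge /precision /excess /scaffold_shift.
by case: (vL _) => [r||]; rewrite ?leey // -EFinB !lee_fin; lia.
Qed.

Lemma filtration_scaffold_choice :
  scaffold_choice p n b vL (fun i => bb i) sigma X mu eps T.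
Proof.
have cop : coprime b (p ^ n).
  by apply: coprime_modz_exp p_pr p_ndvd_bb1 _ => n_gt0; apply: bb_b.
split=> //.
- move=> i i_n; apply: (ram_number_gt0 totram v_pi (sigma_neq1 i_n) _ cop).
    by rewrite -(exp1n n) ltn_exp2r ?prime_gt1 //; lia.
  exact: bb_b.
- move=> i j ij j_n.
  have [i_n j_n'] : (1 <= i <= n)%N /\ (1 <= j <= n)%N by lia.
  have /setDP[_ si] := sigma_H i_n; have /setDP[sj _] := sigma_H j_n'.
  apply: (ram_number_chain_le totram v_pi (chain_sub H_normal) H_ram _ si).
  + by lia.
  + by apply: (subsetP (chain_sub H_normal _)) sj; lia.
  exact: sigma_neq1.
- exact: dval_X_chain.
- exact: dval_mu_chain.
- by move=> j /mu_eps_diag[].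
- exact: sigma_X_chain.
- exact: sigma_X_fix_chain.
exact: vge_eps_chain.
Qed.

End FiltrationChoice.

Theorem theorem2p6
  (p n : nat) (p_pr : prime p)
  (K0 : fieldType) (v0 : discrete_valuation K0)
  (K0_complete : valuation_complete v0)
  (K0_residue : residue_perfect_pchar v0 p)
  (Kn : splittingFieldType K0) (vn : discrete_valuation Kn)
  (Kn_galois : galois 1 {:Kn})
  (Kn_degree : \dim {:Kn} = (p ^ n)%N)
  (Kn_ram : totally_ramified v0 vn)
  (pi0 : K0) (v_pi0 : v0 pi0 = 1%:E)
  (pin : Kn) (v_pin : vn pin = 1%:E)
  (T : nat) (T_ge1 : (1 <= T)%N)
  (H : nat -> {group gal_of {:Kn}})
  (H_0 : H 0%N :=: 'Gal({:Kn} / 1)%g)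
  (H_n : H n :=: 1%g)
  (H_normal : forall i, (1 <= i <= n)%N -> (H i <| H i.-1)%g)
  (H_quo : forall i, (1 <= i <= n)%N -> (H i.-1 / H i \isog Zp p)%g)
  (H_ram : forall t : int, exists2 i : nat, (i <= n)%N &
     ramification_group vn pin t = H i)
  (sigma : nat -> gal_of {:Kn})
  (sigma_H : forall i, (1 <= i <= n)%N -> sigma i \in (H i.-1 :\: H i)%g)
  (v : nat -> Kn -> \bar int)
  (v_norm : forall i, (i <= n)%N -> normalized_on vn (fixedField (H i)) (v i))
  (X : nat -> Kn) (mu : nat -> nat -> K0) (eps : nat -> nat -> Kn) (b : nat) :
  let bb (i : nat) : int := ram_number vn pin (sigma i) in
  let a := frak_a p n b in
  let lam := lambda vn p n b X pi0 in
  (* (A1) *)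
  ~~ (p %| bb 1%N)%Z ->
  (* (A2) *)
  (b < p ^ n)%N ->
  (forall i, (1 <= i <= n)%N -> (bb i = b %[mod (p ^ n)%N])%Z) ->
  (forall j, (1 <= j <= n)%N ->
     [/\ X j \in fixedField (H j),
         v j (X j) = (- bb j)%:E
       & (0 < v j (sigma j (X j) - X j - 1)%R)%E]) ->
  (forall i j, (1 <= i < j)%N -> (j <= n)%N ->
     [/\ sigma i (X j) - X j = (mu i j)%:A + eps i j,
         eps i j \in fixedField (H j),
         v j (mu i j)%:A = (bb i - bb j)%:E
       & ((bb i - bb j)%:E < v j (eps i j))%E]) ->
  (forall j, (1 <= j <= n)%N ->
     mu j j = 1 /\ eps j j = sigma j (X j) - X j - 1) ->
  (* (A3) *)
  (forall i j, (1 <= i <= j)%N -> (j <= n)%N ->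
     (((p%:Z - 1) * (\sum_(1 <= k < i) (p ^ (n - k - 1))%N%:Z * bb k)
        + ((p ^ (n - i))%N%:Z - (p ^ (n - j))%N%:Z) * bb i + T%:Z)%:E
      <= vn (eps i j) - vn (mu i j)%:A)%E) ->
  forall Theta : nat -> gal_ring Kn,
  Theta n = gr_of (sigma n) ->
  (forall i, (1 <= i < n)%N ->
     Theta i = gr_of (sigma i) *
       \prod_(k < n - i) trunc_exp p (Theta (n - k)%N) (- mu i (n - k)%N)) ->
  let Psi (i : nat) : gal_ring Kn := Theta i - 1 in
  [/\ forall t : int, vn (lam t) = t%:E,
      forall t : int, lam (t + (p ^ n)%N%:Z) = pi0 *: lam t,
      forall i, (1 <= i <= n)%N -> gr_act (Psi i) 1 = 0
    & forall (i : nat) (j : int), (1 <= i <= n)%N ->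
        let l := lam (j + (p ^ (n - i))%N%:Z * bb i) in
        lcong vn l T (gr_act (Psi i) (lam j))
          (if (1 <= digit p (a j) (n - i))%N then l else 0)].
Proof.
move=> bb a lam A1 b_lt A2 X_P mu_eps_P mu_eps_diag A3.
move=> Theta Theta_n Theta_lt Psi.
have v_p := residue_pchar_dval_ext Kn_ram K0_residue.1.
have choice : scaffold_choice p n b vn bb sigma X mu eps T.
  exact: (filtration_scaffold_choice p_pr Kn_ram v_pin H_n H_normal H_quo H_ram
    sigma_H v_norm A1 A2 X_P mu_eps_P mu_eps_diag A3).
have Theta_def i : (1 <= i <= n)%N ->
    Theta i = gr_of (sigma i) * trunc_exp_prod p n mu Theta i (n - i).
  move=> i_n; have [->|i_neq_n] := eqVneq i n.
    by rewrite Theta_n subnn /trunc_exp_prod big_ord0 mulr1.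
  by apply: Theta_lt; lia.
split=> [t|t|i i_n|i j i_n l].
- exact: (dval_scaffold_lambda p_pr choice Kn_ram v_p Kn_degree v_pi0).
- exact: (scaffold_lambda_period p_pr choice v_p v_pi0).
- exact: (Psi_fix1 p_pr Theta_def).
exact: (Psi_lambda p_pr Theta_def choice Kn_ram v_p Kn_degree v_pi0).
Qed.
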